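(* Let $\bar x,u\in\mathbb R^n$. Assume that the restricted inf-compactness holds at $\bar x$ in direction $u$ with compact set $\Omega_u$, and that $\mathcal F$ satisfies Robinson stability (RS) at $(\bar x,y)$ in direction $u$ for each $y\in S(\bar x)\cap\Omega_u$. Suppose that for each $y\in S(\bar x)\cap\Omega_u$ and each sign $s\in\{+1,-1\}$ the system in the variable $v\in\mathbb R^m$ $$\nabla P(\bar x,y)(su,v)\in\widehat T_C(P(\bar x,y))$$ is feasible, and that for every $v$ satisfying this system the regularity condition $$\nabla_yP(\bar x,y)^T\lambda=0,\quad \lambda\in N^c_C(P(\bar x,y))\cap\{\nabla P(\bar x,y)(su,v)\}^\perp\ \Longrightarrow\ \lambda=0$$ holds. Then $$\min_{y\in S(\bar x;u)\cap\Omega_u}\ \min_{\lambda\in\Lambda^c(\bar x,y)}\nabla_xL(\bar x,y,\lambda)u\ \le\ V'_-(\bar x;u)\ \le\ V'_+(\bar x;u)\ \le\ \min_{y\in S(\bar x;u)\cap\Omega_u}\ \max_{\lambda\in\Lambda^c(\bar x,y)}\nabla_xL(\bar x,y,\lambda)u .$$ Furthermore, if $\Lambda^c(\bar x,y)=\{\bar\lambda(y)\}$ is a singleton for every $y\in S(\bar x;u)\cap\Omega_u$, then $V$ is Hadamard directionally differentiable at $\bar x$ in direction $u$ and $$V'(\bar x;u)=\min_{y\in S(\bar x;u)\cap\Omega_u}\nabla_xL(\bar x,y,\bar\lambda(y))u .$$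
   Context: Setting: $f:\mathbb R^n\times\mathbb R^m\to\mathbb R$ and $P:\mathbb R^n\times\mathbb R^m\to\mathbb R^p$ are continuously differentiable and $C\subseteq\mathbb R^p$ is closed (not necessarily convex). For $x\in\mathbb R^n$, problem $(P_x)$ is $\min_{y\in\mathbb R^m} f(x,y)$ s.t. $P(x,y)\in C$. Put $\mathcal F(x):=\{y\in\mathbb R^m: P(x,y)\in C\}$, $V(x):=\inf\{f(x,y): y\in\mathcal F(x)\}$ (with $\inf\emptyset=+\infty$), $S(x):=\arg\min\{f(x,y): y\in\mathcal F(x)\}$, and $L(x,y,\lambda):=f(x,y)+P(x,y)^T\lambda$. Write $\nabla P(\bar x,y)(u,v):=\nabla_xP(\bar x,y)u+\nabla_yP(\bar x,y)v$. Cones: for closed $\Omega$ and $\bar z\in\Omega$, $\widehat N_\Omega(\bar z)=\{\zeta:\langle\zeta,z-\bar z\rangle\le o(\|z-\bar z\|)\ \forall z\in\Omega\}$ is the regular normal cone; $N_\Omega(\bar z)=\{\zeta:\exists z_k\to\bar z,\ z_k\in\Omega,\ \zeta_k\to\zeta,\ \zeta_k\in\widehat N_\Omega(z_k)\}$ is the limiting normal cone; $N^c_\Omega(\bar z)=\mathrm{cl\,co}\,N_\Omega(\bar z)$ is the Clarke normal cone; $\widehat T_\Omega(\bar z)$ is the regular (Clarke) tangent cone: $d\in\widehat T_\Omega(\bar z)$ iff for all $t_k\downarrow0$ and $z_k\to\bar z$ in $\Omega$ there exist $w_k\to\bar z$ in $\Omega$ with $(w_k-z_k)/t_k\to d$.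 Clarke multipliers: $\Lambda^c(\bar x,y):=\{\lambda\in N^c_C(P(\bar x,y)):\nabla_yf(\bar x,y)+\nabla_yP(\bar x,y)^T\lambda=0\}$. Directional neighborhood: for $\varepsilon,\delta>0$, $\mathcal V_{\varepsilon,\delta}(d):=\{0\}\cup\{z\in\varepsilon\mathbb B\setminus\{0\}:\|z/\|z\|-d/\|d\|\|\le\delta\}$ if $d\ne0$, and $\mathcal V_{\varepsilon,\delta}(0):=\varepsilon\mathbb B$, where $\mathbb B$ is the open unit ball. Restricted inf-compactness at $\bar x$ in direction $u$ with compact set $\Omega_u\subseteq\mathbb R^m$: $V(\bar x)$ is finite and there are $\varepsilon,\delta>0$ such that $S(x)\cap\Omega_u\ne\emptyset$ for all $x\in\bar x+\mathcal V_{\varepsilon,\delta}(u)$ with $V(x)<V(\bar x)+\varepsilon$. Robinson stability (RS) of $\mathcal F$ at $(\bar x,\bar y)$, $\bar y\in\mathcal F(\bar x)$, in direction $u$: there are $\kappa\ge0$, $\varepsilon,\delta>0$ with $\mathrm{dist}(y,\mathcal F(x))\le\kappa\,\mathrm{dist}(P(x,y),C)$ for all $(x,y)\in(\bar x,\bar y)+\mathcal V_{\varepsilon,\delta}(u)\times\varepsilon\mathbb B$. Directional solution set: $S(\bar x;u):=\{y\in S(\bar x):\exists t_k\downarrow0,\ u^k\to u,\ y^k\to y,\ y^k\in S(\bar x+t_ku^k)\}$. Dini derivatives (Hadamard sense): $V'_+(\bar x;u)$ and $V'_-(\bar x;u)$ are respectively the $\limsup$ and $\liminf$ of $(V(\bar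 x+tu')-V(\bar x))/t$ as $t\downarrow0$, $u'\to u$. If both are finite and equal, $V$ is Hadamard directionally differentiable at $\bar x$ in direction $u$ and the common value is $V'(\bar x;u)$.
   Formalization: In the first display the outer minima over S(x̄;u)∩Ω_u, which need not be attained, are read as infima; for the lower bound some y in S(x̄;u)∩Ω_u with min over Λ^c of ∇_xL·u ≤ V'_- is also given. *)

(* Defs.v *)
From HB Require Import structures.
From mathcomp Require Import all_boot all_order all_algebra.
From mathcomp Require Import all_classical all_reals all_analysis.

Set Implicit Arguments.
Unset Strict Implicit.
Unset Printing Implicit Defensive.

Import Order.TTheory GRing.Theory Num.Theory.
Import numFieldNormedType.Exports.

Local Open Scope classical_set_scope.
Local Open Scope ring_scope.

(* Vectors are row vectors. The library norm on 'rV[R]_n is the sup norm; it is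
   used only through the topology it induces. Wherever the value of a norm
   matters, the Euclidean norm [enorm] below is used. *)

Section Euclidean.
Context {R : realType} {n : nat}.
Implicit Types (u v z : 'rV[R]_n) (A : set 'rV[R]_n).

Definition dotv u v : R := (u *m v^T) 0 0.

Definition enorm u : R := Num.sqrt (dotv u u).

(* The distance to the empty set is +oo. *)
Definition dist z A : \bar R := ereal_inf [set (enorm (z - a))%:E | a in A].

Definition dir_nbhd (eps delta : R) (d : 'rV[R]_n) : set 'rV[R]_n :=
  if d == 0 then [set z | enorm z < eps]
  else [set z | z = 0 \/
    [/\ enorm z < eps, z != 0
      & enorm ((enorm z)^-1 *: z - (enorm d)^-1 *: d) <= delta]].

End Euclidean.

Section Calculus.
Context {R : realType}.

(* Continuous differentiability: the derivative z |-> 'd F z is continuous for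
   the operator norm. *)
Definition C1 {V W : normedModType R} (F : V -> W) : Prop :=
  (forall z, differentiable F z) /\
  (forall (z : V) (eps : R), 0 < eps -> \forall z' \near z,
     forall h, `|'d F z' h - 'd F z h| <= eps * `|h|).

Definition grad {n : nat} (g : 'rV[R]_n -> R) (z : 'rV[R]_n) : 'rV[R]_n :=
  \row_j 'd (g : 'rV[R]_n -> R^o) z (delta_mx 0 j).

(* The library's 'J g z acts on row vectors from the right ('d g z v is
   v *m 'J g z); the usual Jacobian is its transpose. *)
Definition Jac {n p : nat} (g : 'rV[R]_n -> 'rV[R]_p) (z : 'rV[R]_n) :
  'M[R]_(p, n) := ('J g z)^T.

End Calculus.

Section Cones.
Context {R : realType} {p : nat}.
Implicit Types (Omega : set 'rV[R]_p) (z zeta d : 'rV[R]_p).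

Definition regular_normal Omega z : set 'rV[R]_p :=
  [set zeta | Omega z /\ forall eps : R, 0 < eps -> \forall z' \near z,
     Omega z' -> dotv zeta (z' - z) <= eps * enorm (z' - z)].

Definition limiting_normal Omega z : set 'rV[R]_p :=
  [set zeta | exists z_ zeta_ : nat -> 'rV[R]_p,
     [/\ forall k, Omega (z_ k), z_ @ \oo --> z, zeta_ @ \oo --> zeta
       & forall k, regular_normal Omega (z_ k) (zeta_ k)]].

Definition convex_hull (A : set 'rV[R]_p) : set 'rV[R]_p :=
  smallest (@convex_set R 'rV[R]_p) A.

Definition clarke_normal Omega z : set 'rV[R]_p :=
  closure (convex_hull (limiting_normal Omega z)).

Definition regular_tangent Omega z : set 'rV[R]_p :=
  [set d | Omega z /\ forall (t_ : nat -> R) (z_ : nat -> 'rV[R]_p),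
     (forall k, 0 < t_ k) -> t_ @ \oo --> (0 : R) ->
     (forall k, Omega (z_ k)) -> z_ @ \oo --> z ->
     exists w_ : nat -> 'rV[R]_p,
       [/\ forall k, Omega (w_ k), w_ @ \oo --> z
         & (fun k => (t_ k)^-1 *: (w_ k - z_ k)) @ \oo --> d]].

End Cones.

Section Dini.
Context {R : realType} {n : nat}.
Variable V : 'rV[R]_n -> \bar R.

(* The quotient, as a function of (t, u'); meaningful when V x is finite. *)
Definition diff_quotient (x : 'rV[R]_n) (q : R * 'rV[R]_n) : \bar R :=
  ((V (x + q.1 *: q.2) - V x) * (q.1^-1)%:E)%E.

Definition dini_upper (x u : 'rV[R]_n) : \bar R :=
  limf_esup (diff_quotient x) (filter_prod 0^'+ (nbhs u)).

Definition dini_lower (x u : 'rV[R]_n) : \bar R :=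
  limf_einf (diff_quotient x) (filter_prod 0^'+ (nbhs u)).

Definition is_hadamard_derivative (x u : 'rV[R]_n) (d : R) : Prop :=
  dini_upper x u = d%:E /\ dini_lower x u = d%:E.

End Dini.

Definition is_min {R : realType} (A : set R) (a : R) : Prop :=
  A a /\ forall b, A b -> a <= b.

Definition is_max {R : realType} (A : set R) (a : R) : Prop :=
  A a /\ forall b, A b -> b <= a.

Section ParametricProblem.
Context {R : realType} {n m p : nat}.
Variables (f : 'rV[R]_n * 'rV[R]_m -> R) (P : 'rV[R]_n * 'rV[R]_m -> 'rV[R]_p).
Variable C : set 'rV[R]_p.

Definition feasible (x : 'rV[R]_n) : set 'rV[R]_m := [set y | C (P (x, y))].

Definition value (x : 'rV[R]_n) : \bar R :=
  ereal_inf [set (f (x, y))%:E | y in feasible x].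

Definition solutions (x : 'rV[R]_n) : set 'rV[R]_m :=
  [set y | feasible x y /\ forall y', feasible x y' -> f (x, y) <= f (x, y')].

Definition lagrangian (x : 'rV[R]_n) (y : 'rV[R]_m) (lambda : 'rV[R]_p) : R :=
  f (x, y) + dotv (P (x, y)) lambda.

(* The derivative of the Lagrangian in x, applied to u. *)
Definition gradxL (x : 'rV[R]_n) (y : 'rV[R]_m) (lambda : 'rV[R]_p)
    (u : 'rV[R]_n) : R :=
  dotv (grad (fun x' => lagrangian x' y lambda) x) u.

Definition JacxP (x : 'rV[R]_n) (y : 'rV[R]_m) : 'M[R]_(p, n) :=
  Jac (fun x' => P (x', y)) x.

Definition JacyP (x : 'rV[R]_n) (y : 'rV[R]_m) : 'M[R]_(p, m) :=
  Jac (fun y' => P (x, y')) y.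

Definition derP (x : 'rV[R]_n) (y : 'rV[R]_m) (u : 'rV[R]_n) (v : 'rV[R]_m) :
  'rV[R]_p := u *m (JacxP x y)^T + v *m (JacyP x y)^T.

(* With row vectors, lambda *m JacyP x y is the transpose of the column
   (JacyP x y)^T *m lambda^T. *)
Definition clarke_multipliers (x : 'rV[R]_n) (y : 'rV[R]_m) : set 'rV[R]_p :=
  [set lambda | clarke_normal C (P (x, y)) lambda /\
     grad (fun y' => f (x, y')) y + lambda *m JacyP x y = 0].

Definition restricted_inf_compact (x u : 'rV[R]_n) (Omega : set 'rV[R]_m) :
    Prop :=
  [/\ compact Omega, value x \is a fin_num
    & exists eps delta : R, [/\ 0 < eps, 0 < delta
      & forall x', dir_nbhd eps delta u (x' - x) ->
          (value x' < value x + eps%:E)%E ->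
          solutions x' `&` Omega !=set0]].

Definition robinson_stable (x : 'rV[R]_n) (y : 'rV[R]_m) (u : 'rV[R]_n) :
    Prop :=
  feasible x y /\
  exists kappa eps delta : R, [/\ 0 <= kappa, 0 < eps, 0 < delta
    & forall x' y', dir_nbhd eps delta u (x' - x) -> enorm (y' - y) < eps ->
        (dist y' (feasible x') <= kappa%:E * dist (P (x', y')) C)%E].

Definition dir_solutions (x u : 'rV[R]_n) : set 'rV[R]_m :=
  [set y | solutions x y /\
     exists (t_ : nat -> R) (u_ : nat -> 'rV[R]_n) (y_ : nat -> 'rV[R]_m),
       [/\ forall k, 0 < t_ k, t_ @ \oo --> (0 : R), u_ @ \oo --> u,
           y_ @ \oo --> y
         & forall k, solutions (x + t_ k *: u_ k) (y_ k)]].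

(* The system in v and the regularity condition at y, in the direction w. *)
Definition dir_regular (x : 'rV[R]_n) (y : 'rV[R]_m) (w : 'rV[R]_n) : Prop :=
  (exists v, regular_tangent C (P (x, y)) (derP x y w v)) /\
  forall v, regular_tangent C (P (x, y)) (derP x y w v) ->
    forall lambda, lambda *m JacyP x y = 0 ->
      clarke_normal C (P (x, y)) lambda ->
      dotv lambda (derP x y w v) = 0 -> lambda = 0.

End ParametricProblem.

(* Main.v *)
(** For [d] in the polar of the limiting normal cone of [C] at [P (x, y)], points
    of [C] near [P (x, y)] can be displaced by [t d + o(t)] inside [C], uniformly
    in the starting point. With Robinson stability this turns a direction [(w, v)]
    such that [DP(x, y)(w, v)] lies in that polar into feasible points
    [y1 + t v + o(t)] over [x1 + t w]. The best rate in the objective over such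
    [v] is a conic linear program, whose dual value is the maximum of
    [grad_x L (x, y, l) w] over the Clarke multipliers [l]; regularity for both
    signs of [u] gives the qualification [l B = 0 -> l = 0] on the Clarke normal
    cone, [B] being the Jacobian of [P] in [y], which makes Farkas' lemma
    available and the multiplier set compact and nonempty.
    Starting at a solution [y] and moving along [u] bounds the upper derivative;
    starting at solutions over [x + t_k u_k], which cluster in [Omega] at a
    directional solution, and moving back along [- u] bounds the lower one. *)

Require Import Defs.
From HB Require Import structures.
From mathcomp Require Import all_boot all_order all_algebra.
From mathcomp Require Import all_classical all_reals all_analysis.
From mathcomp Require Import ring lra.

Set Implicit Arguments.
Unset Strict Implicit.
Unset Printing Implicit Defensive.

Import Order.TTheory GRing.Theory Num.Theory.
Import numFieldNormedType.Exports.

Local Open Scope classical_set_scope.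
Local Open Scope ring_scope.

(** * Euclidean norm *)

Section EuclideanNorm.
Context {R : realType} {n : nat}.
Implicit Types (u v w : 'rV[R]_n) (a : R).

Lemma dotvE u v : dotv u v = \sum_i u 0 i * v 0 i.
Proof. by rewrite /dotv mxE; apply: eq_bigr => i _; rewrite mxE. Qed.

Lemma dotvC u v : dotv u v = dotv v u.
Proof. by rewrite !dotvE; apply: eq_bigr => i _; rewrite mulrC. Qed.

Lemma dotvDl u v w : dotv (u + v) w = dotv u w + dotv v w.
Proof. by rewrite /dotv mulmxDl mxE. Qed.

Lemma dotvZl a u v : dotv (a *: u) v = a * dotv u v.
Proof. by rewrite /dotv -scalemxAl mxE. Qed.

Lemma dotvDr u v w : dotv w (u + v) = dotv w u + dotv w v.
Proof. by rewrite dotvC dotvDl !(dotvC w). Qed.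

Lemma dotvZr a u v : dotv u (a *: v) = a * dotv u v.
Proof. by rewrite dotvC dotvZl dotvC. Qed.

Lemma dotvNl u v : dotv (- u) v = - dotv u v.
Proof. by rewrite -scaleN1r dotvZl mulN1r. Qed.

Lemma dotvNr u v : dotv u (- v) = - dotv u v.
Proof. by rewrite dotvC dotvNl dotvC. Qed.

Lemma dotv0l v : dotv 0 v = 0.
Proof. by rewrite /dotv mul0mx mxE. Qed.

Lemma dotv0r v : dotv v 0 = 0.
Proof. by rewrite dotvC dotv0l. Qed.

Lemma dotvv_ge0 u : 0 <= dotv u u.
Proof. by rewrite dotvE; apply: sumr_ge0 => i _; rewrite -expr2 sqr_ge0. Qed.

Lemma enorm_ge0 u : 0 <= enorm u.
Proof. exact: sqrtr_ge0. Qed.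

Lemma sqr_enorm u : enorm u ^+ 2 = dotv u u.
Proof. by rewrite sqr_sqrtr// dotvv_ge0. Qed.

Lemma mx_coord_le u i : `|u 0 i| <= `|u|.
Proof.
rewrite [leRHS]/Num.Def.normr /= mx_normrE.
by apply/bigmax_geP; right; exists (0, i).
Qed.

Lemma mx_norm_leP u a : 0 <= a -> (forall i, `|u 0 i| <= a) -> `|u| <= a.
Proof.
move=> a0 ua; rewrite [leLHS]/Num.Def.normr /= mx_normrE.
by apply/bigmax_leP; split => // -[i j] _ /=; rewrite ord1.
Qed.

Lemma norm_le_enorm u : `|u| <= enorm u.
Proof.
apply: mx_norm_leP; first exact: enorm_ge0.
move=> i; rewrite -sqrtr_sqr; apply: ler_wsqrtr.
rewrite dotvE (bigD1 i)//= -expr2 lerDl.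
by apply: sumr_ge0 => j _; rewrite -expr2 sqr_ge0.
Qed.

Lemma enorm_le_norm u : enorm u <= n%:R * `|u|.
Proof.
have h : dotv u u <= (n%:R * `|u|) ^+ 2.
  rewrite dotvE; apply: (@le_trans _ _ (\sum_(i < n) `|u| ^+ 2)).
    apply: ler_sum => i _; rewrite -expr2 -real_normK ?num_real//.
    by rewrite lerXn2r ?nnegrE// mx_coord_le.
  rewrite sumr_const card_ord exprMn -[leLHS]mulr_natl ler_wpM2r ?sqr_ge0//.
  by rewrite -natrX ler_nat; case: (n) => // k; rewrite expnS leq_pmulr// expn1.
by apply: le_trans (ler_wsqrtr h) _; rewrite sqrtr_sqr ger0_norm// mulr_ge0.
Qed.

Lemma enormZ a u : enorm (a *: u) = `|a| * enorm u.
Proof.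
by rewrite /enorm dotvZl dotvZr mulrA -expr2 sqrtrM ?sqr_ge0// sqrtr_sqr.
Qed.

Lemma enormN u : enorm (- u) = enorm u.
Proof. by rewrite -scaleN1r enormZ normrN1 mul1r. Qed.

Lemma enorm0 : enorm (0 : 'rV[R]_n) = 0.
Proof. by rewrite /enorm dotv0l sqrtr0. Qed.

Lemma enorm_eq0 u : (enorm u == 0) = (u == 0).
Proof.
apply/eqP/eqP => [u0|->]; last exact: enorm0.
by apply/eqP; rewrite -normr_le0 -u0 norm_le_enorm.
Qed.

Lemma enorm_gt0 u : (0 < enorm u) = (u != 0).
Proof. by rewrite lt_def enorm_ge0 andbT enorm_eq0. Qed.

Lemma sqr_enormD u v :
  enorm (u + v) ^+ 2 = enorm u ^+ 2 + 2 * dotv u v + enorm v ^+ 2.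
Proof. by rewrite !sqr_enorm dotvDl !dotvDr (dotvC v u); ring. Qed.

Lemma dotv_le u v : dotv u v <= enorm u * enorm v.
Proof.
have [->|v0] := eqVneq v 0; first by rewrite dotv0r enorm0 mulr0.
have h : dotv u v ^+ 2 <= (enorm u * enorm v) ^+ 2.
  have := dotvv_ge0 ((enorm v ^+ 2) *: u - dotv u v *: v).
  rewrite -sqr_enorm sqr_enormD enormN !enormZ dotvNr dotvZl dotvZr.
  rewrite !exprMn !real_normK ?num_real// => h.
  have v1 : 0 < enorm v ^+ 2 by rewrite exprn_gt0// enorm_gt0.
  rewrite -(ler_pM2l v1); nra.
have := enorm_ge0 u; have := enorm_ge0 v => ? ?.
apply: le_trans (ler_norm _) _.
by rewrite -ler_sqr ?nnegrE ?mulr_ge0// real_normK ?num_real.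
Qed.

Lemma enormD u v : enorm (u + v) <= enorm u + enorm v.
Proof.
rewrite -ler_sqr ?nnegrE ?addr_ge0 ?enorm_ge0// sqr_enormD.
by have := dotv_le u v; nra.
Qed.

Lemma enormB u v : enorm (u - v) = enorm (v - u).
Proof. by rewrite -enormN opprB. Qed.

End EuclideanNorm.

Section Continuity.
Context {R : realType} {n : nat} {T : Type} {F : set_system T} {FF : Filter F}.
Implicit Types f g : T -> 'rV[R]_n.

Lemma cvg_coord f (l : 'rV[R]_n) i :
  f @ F --> l -> (fun t => f t 0 i) @ F --> l 0 i.
Proof.
move=> fl; have := @coord_continuous R 1 n 0 i l; rewrite /continuous_at.
exact: cvg_comp fl.
Qed.

Lemma cvg_dotv f g (l k : 'rV[R]_n) :
  f @ F --> l -> g @ F --> k -> (fun t => dotv (f t) (g t)) @ F --> dotv l k.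
Proof.
move=> fl gk; under eq_fun do rewrite dotvE; rewrite dotvE.
apply: cvg_big => [|i _]; first exact: add_continuous.
by apply: cvgM; exact: cvg_coord.
Qed.

Lemma cvg_enorm f (l : 'rV[R]_n) :
  f @ F --> l -> (fun t => enorm (f t)) @ F --> enorm l.
Proof.
move=> fl; have := @sqrt_continuous R (dotv l l).
by apply: cvg_comp; exact: cvg_dotv.
Qed.

End Continuity.

(** * Compactness and projections *)

Section Sequences.
Context {R : realType} {V : normedModType R}.
Implicit Types (l : V).

Lemma cvg_seqP (u_ : nat -> V) l : u_ @ \oo --> l <->
  forall e : R, 0 < e -> exists N, forall k, (N <= k)%N -> `|u_ k - l| < e.
Proof.
split=> [ul e e0|h].
  have /cvgrPdist_lt/(_ e e0) [N _ hN] := ul.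
  by exists N => k Nk; rewrite distrC; exact: hN.
apply/cvgrPdist_lt => e e0; have [N hN] := h e e0.
by exists N => // k Nk; rewrite /= distrC; exact: hN.
Qed.

Lemma cvg_seq_harmonic (u_ : nat -> V) l :
  (forall k, `|u_ k - l| <= k.+1%:R^-1) -> u_ @ \oo --> l.
Proof.
move=> ul; apply/cvg_seqP => e e0.
have /cvgrPdist_lt/(_ e e0) [N _ hN] := @cvg_harmonic R.
exists N => k /hN /=; rewrite sub0r normrN ger0_norm ?invr_ge0//.
exact: le_lt_trans.
Qed.

Lemma cvg_comp_subseq (T : topologicalType) (w_ : nat -> T) (a : T)
    (phi : nat -> nat) :
  (forall k, (k <= phi k)%N) -> w_ @ \oo --> a ->
  (fun k => w_ (phi k)) @ \oo --> a.
Proof.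
move=> kphi wa; apply: (@cvg_comp _ _ _ phi w_ _ \oo) => // A [N _ NA].
by exists N => // k /= Nk; apply: NA => /=; exact: leq_trans Nk (kphi k).
Qed.

Lemma compact_subseq (A : set V) (u_ : nat -> V) :
  compact A -> (forall k, A (u_ k)) ->
  exists phi l, [/\ A l, forall k, (k <= phi k)%N &
    (fun k => u_ (phi k)) @ \oo --> l].
Proof.
move=> cA uA; have [|l [Al cl]] := cA (u_ @ \oo) _; first by exists 0%N => // k _; exact: uA.
have /choice[phi hphi] (k : nat) : exists j, (k <= j)%N /\ `|u_ j - l| < k.+1%:R^-1.
  have [] := cl (u_ @` [set j | (k <= j)%N]) (ball l k.+1%:R^-1).
  - by exists k => // j /= kj; exists j.
  - by apply: nbhsx_ballx; rewrite invr_gt0.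
  move=> _ [[j /= kj <-]]; rewrite -ball_normE /= distrC => h; by exists j.
exists phi, l; split => // [k|]; first by have [] := hphi k.
by apply: cvg_seq_harmonic => k; apply/ltW; have [] := hphi k.
Qed.

End Sequences.

Section FiniteDimension.
Context {R : realType} {n : nat}.
Implicit Types (C A : set 'rV[R]_n) (q w z : 'rV[R]_n).

Lemma bounded_subseq (u_ : nat -> 'rV[R]_n) (M : R) :
  (forall k, `|u_ k| <= M) ->
  exists (phi : nat -> nat) (l : 'rV[R]_n),
    (forall k, (k <= phi k)%N) /\ (fun k => u_ (phi k)) @ \oo --> l.
Proof.
move=> uM; have cM : compact [set z : 'rV[R]_n | `|z| <= M].
  apply: bounded_closed_compact.
    exists M; split; first exact: num_real.
    by move=> a Ma z /= /le_trans; apply; exact: ltW.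
  apply: (@preimage_closed _ _ (fun z : 'rV[R]_n => `|z|) [set x | x <= M]).
    by move=> z _; exact: norm_continuous.
  exact: closed_le.
by have [phi [l [_ ? ?]]] := compact_subseq cM uM; exists phi, l.
Qed.

Lemma continuous_enormB q : continuous (fun w => enorm (q - w)).
Proof.
move=> w; have FF : Filter (nbhs (w : 'rV[R]_n)) by exact: nbhs_filter.
have h := @cvgB _ _ _ _ FF _ _ _ _ (cvg_cst q) cvg_id.
exact: (@cvg_enorm _ _ _ _ FF (fun w => q - w) _ (h FF)).
Qed.

Lemma closed_projection C q : closed C -> C !=set0 ->
  exists w, C w /\ forall w', C w' -> enorm (q - w) <= enorm (q - w').
Proof.
move=> Ccl [c Cc].
pose A := C `&` [set w | enorm (q - w) <= enorm (q - c)].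
have Acl : closed A.
  apply: closedI => //.
  apply: (@preimage_closed _ _ (fun w => enorm (q - w)) [set x | x <= _]).
    by move=> w _; exact: continuous_enormB.
  exact: closed_le.
have Ab : bounded_set A.
  exists (`|q| + enorm (q - c)); split; first exact: num_real.
  move=> a Ma w [_ /= h]; apply: le_trans (ltW Ma).
  rewrite -[w](subKr q); apply: le_trans (ler_normB _ _) _.
  by rewrite lerD2l (le_trans _ h)// norm_le_enorm.
have [|||w wA h] := @EVT_min_rV R n (fun w => enorm (q - w)) A.
- by exists c; split => /=.
- exact: bounded_closed_compact.
- exact/continuous_subspaceT/continuous_enormB.
move: wA; rewrite inE => -[Cw wc]; exists w; split => // w' Cw'.
have [le|lt] := leP (enorm (q - w')) (enorm (q - c)).
  by apply: h; rewrite inE.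
exact: le_trans wc (ltW lt).
Qed.

Lemma sqr_projection C q w : (forall w', C w' -> enorm (q - w) <= enorm (q - w')) ->
  forall w', C w' -> 2 * dotv (q - w) (w' - w) <= enorm (w' - w) ^+ 2.
Proof.
move=> h w' /h; rewrite -(opprK (w' - w)) opprB.
rewrite -ler_sqr ?nnegrE ?enorm_ge0//.
have -> : q - w' = (q - w) + (w - w') by rewrite addrA subrK.
by rewrite (sqr_enormD (q - w)) dotvNr enormN; lra.
Qed.

Lemma regular_normal_projection C q w (a : R) : C w -> 0 <= a ->
  (forall w', C w' -> enorm (q - w) <= enorm (q - w')) ->
  regular_normal C w (a *: (q - w)).
Proof.
move=> Cw a0 /sqr_projection h; split=> // eps eps0.
have d0 : 0 < eps / (n%:R * (a + 1) + 1).
  by rewrite divr_gt0// ltr_wpDl// mulr_ge0// addr_ge0.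
apply: filterS (nbhsx_ballx w _ d0) => w'; rewrite -ball_normE /= => ww' Cw'.
have := h w' Cw'; have := enorm_ge0 (w' - w); have := enorm_le_norm (w' - w).
rewrite dotvZl distrC; move: ww'; rewrite ltr_pdivlMr; last first.
  by rewrite ltr_wpDl// mulr_ge0// addr_ge0.
have n0 : 0 <= n%:R :> R by [].
have := normr_ge0 (w - w').
move: (dotv _ _) (enorm _) (`|_|) (n%:R : R) n0 => D e N k k0 N0 Nlt ek e0 De.
have h1 : a * e <= eps.
  apply: le_trans (ltW Nlt); apply: (@le_trans _ _ (a * (k * N))).
    exact: ler_wpM2l.
  have : 0 <= N * k by exact: mulr_ge0.
  nra.
have : 2 * (a * D) <= eps * e; last by nra.
apply: (@le_trans _ _ (a * e ^+ 2)); first by nra.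
by rewrite expr2 mulrA ler_wpM2r.
Qed.

End FiniteDimension.

(** * Displacement of points of a closed set *)

Section TangentApproach.
Context {R : realType} {p : nat}.
Variables (C : set 'rV[R]_p) (z d : 'rV[R]_p).
Hypothesis C_closed : closed C.
Hypothesis Cz : C z.
Hypothesis d_polar : forall zeta, limiting_normal C z zeta -> dotv zeta d <= 0.

Let nearest q w := C w /\ forall w', C w' -> enorm (q - w) <= enorm (q - w').

Lemma projection_dotv_le (eps : R) : 0 < eps -> exists r : R, 0 < r /\
  forall q w, `|q - z| < r -> nearest q w ->
    dotv (q - w) d <= eps * enorm (q - w).
Proof.
move=> eps0; apply: contrapT => /forallNP H.
have /choice[qw hqw] (k : nat) : exists qw : 'rV[R]_p * 'rV[R]_p,
    [/\ `|qw.1 - z| < k.+1%:R^-1, nearest qw.1 qw.2 &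
        eps * enorm (qw.1 - qw.2) < dotv (qw.1 - qw.2) d].
  have := H k.+1%:R^-1; rewrite not_andP => -[|]; first by rewrite invr_gt0.
  move=> /existsNP[q /existsNP[w /not_implyP[h1 /not_implyP[h2 h3]]]].
  by exists (q, w); split => //=; rewrite ltNge; apply/negP.
pose q k := (qw k).1; pose w k := (qw k).2.
have qw0 k : 0 < enorm (q k - w k).
  rewrite enorm_gt0; apply/eqP => e; have [_ _] := hqw k.
  by rewrite -/(q k) -/(w k) e enorm0 dotv0l mulr0 ltxx.
pose nu k := (enorm (q k - w k))^-1 *: (q k - w k).
have nu1 k : `|nu k| <= 1.
  apply: le_trans (norm_le_enorm _) _.
  by rewrite enormZ gtr0_norm ?invr_gt0// mulVf// gt_eqF.
have [phi [l [kphi nul]]] := bounded_subseq nu1.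
have qz : q @ \oo --> z.
  by apply: cvg_seq_harmonic => k; have [/ltW] := hqw k.
have wz : w @ \oo --> z.
  apply/cvg_seqP => e e0; have p1 : 0 < p%:R + 1 :> R by rewrite ltr_wpDl.
  have /cvg_seqP/(_ (e / (p%:R + 1))) [|N hN] := qz; first by rewrite divr_gt0.
  exists N => k /hN; rewrite ltr_pdivlMr// => h.
  apply: le_lt_trans h.
  have -> : w k - z = (q k - z) - (q k - w k) by rewrite opprB [RHS]addrC addrA subrK.
  apply: le_trans (ler_normB _ _) _; rewrite mulrDr mulr1 [leLHS]addrC lerD2r.
  apply: le_trans (norm_le_enorm _) _; have [_ [_ h] _] := hqw k.
  by apply: le_trans (h _ Cz) _; rewrite mulrC enorm_le_norm.
have nl : limiting_normal C z l.
  exists (w \o phi), (nu \o phi); split => //.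
  - by move=> k; have [_ []] := hqw (phi k).
  - exact: cvg_comp_subseq wz.
  - move=> k; have [_ [h1 h2] _] := hqw (phi k).
    by apply: regular_normal_projection => //; rewrite invr_ge0 enorm_ge0.
have := d_polar nl; apply/negP; rewrite -ltNge; apply: lt_le_trans eps0 _.
apply: (@closed_cvg _ _ \oo _ (fun k => dotv (nu (phi k)) d) (fun x => eps <= x)).
- exact: closed_ge.
- exists 0%N => // k _ /=; rewrite dotvZl ler_pdivlMl// mulrC.
  by have [_ _ /ltW] := hqw (phi k).
- by apply: cvg_dotv nul _; exact: cvg_cst.
Qed.

(* The squared distance from [z' + s *: d] to [C] is followed along [N] equal
   steps: each step costs at most twice [d] against a proximal normal, which is
   almost nonpositive, plus a square term that vanishes as [N] grows. *)
Lemma tangent_approach (eps : R) : 0 < eps -> exists r : R, 0 < r /\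
  forall z' t, C z' -> `|z' - z| < r -> 0 <= t < r ->
    exists w, C w /\ enorm (w - (z' + t *: d)) <= eps * t.
Proof.
move=> eps0; pose D := enorm d; have D0 : 0 <= D by exact: enorm_ge0.
pose e0 := eps ^+ 2 / (4 * (D + 1)).
have e00 : 0 < e0 by rewrite divr_gt0 ?exprn_gt0// mulr_gt0// ltr_wpDl.
have [r0 [r00 hr0]] := projection_dotv_le e00.
have d1 : 0 < 1 + `|d| by rewrite ltr_pwDl.
exists (r0 / (1 + `|d|)); split; first exact: divr_gt0.
move=> z' t Cz' z'z /andP[t0 tr].
pose N := (Num.truncn (2 * D ^+ 2 / eps ^+ 2)).+1.
have N0 : 0 < N%:R :> R by rewrite ltr0n.
have DN : 2 * D ^+ 2 <= eps ^+ 2 * N%:R.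
  by rewrite [leRHS]mulrC -ler_pdivrMr ?exprn_gt0// ltW// truncnS_gt.
pose h := t / N%:R; have h0 : 0 <= h by rewrite divr_ge0// ltW.
have hN : N%:R * h = t by rewrite /h mulrC divfK// gt_eqF.
have step k : (k <= N)%N -> exists w, nearest (z' + (k%:R * h) *: d) w /\
    enorm (z' + (k%:R * h) *: d - w) ^+ 2 <=
      k%:R * (2 * h * e0 * t * D + h ^+ 2 * D ^+ 2).
  elim: k => [_|k IH kN].
    have [w [Cw hw]] := closed_projection z' C_closed (ex_intro _ z' Cz').
    rewrite !mul0r scale0r addr0; exists w; split => //.
    have := hw _ Cz'; rewrite subrr enorm0 => w0.
    have /eqP -> : enorm (z' - w) == 0 by rewrite eq_le w0 enorm_ge0.
    by rewrite expr0n.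
  have [w [[Cw hw] wk]] := IH (ltnW kN).
  set q := z' + (k%:R * h) *: d in hw wk.
  have kt : k%:R * h <= t by rewrite -hN ler_wpM2r// ler_nat ltnW.
  have -> : z' + (k.+1%:R * h) *: d = q + h *: d.
    by rewrite /q -addrA -scalerDl -natr1 mulrDl mul1r.
  have [w' [Cw' hw']] := closed_projection (q + h *: d) C_closed (ex_intro _ z' Cz').
  exists w'; split => //.
  apply: (@le_trans _ _ (enorm (q + h *: d - w) ^+ 2)).
    by rewrite ler_sqr ?nnegrE ?enorm_ge0//; exact: hw'.
  have -> : q + h *: d - w = (q - w) + h *: d by rewrite addrAC.
  rewrite sqr_enormD enormZ exprMn real_normK ?num_real// dotvZr -/D -natr1 mulrDl mul1r.
  have qz : `|q - z| < r0.
    have -> : q - z = (z' - z) + (k%:R * h) *: d by rewrite /q addrAC.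
    apply: le_lt_trans (ler_normD _ _) _; rewrite normrZ ger0_norm ?mulr_ge0//.
    have kd : k%:R * h * `|d| <= t * `|d| by rewrite ler_wpM2r.
    have : r0 / (1 + `|d|) * (1 + `|d|) = r0 by rewrite divfK// gt_eqF.
    have : t * `|d| <= r0 / (1 + `|d|) * `|d| by rewrite ler_wpM2r// ltW.
    lra.
  have qw := hr0 q w qz (conj Cw hw).
  have qD : enorm (q - w) <= t * D.
    apply: le_trans (hw _ Cz') _; rewrite /q addrAC subrr add0r enormZ.
    by rewrite ger0_norm ?mulr_ge0// ler_wpM2r.
  have : h * dotv (q - w) d <= h * (e0 * (t * D)).
    by apply: ler_wpM2l => //; apply: le_trans qw _; rewrite ler_wpM2l// ltW.
  lra.
have [w [[Cw hw] wN]] := step N (leqnn N).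
exists w; split => //; move: wN; rewrite hN => wN.
rewrite enormB -ler_sqr ?nnegrE ?enorm_ge0 ?mulr_ge0// ?(ltW eps0)//.
apply: le_trans wN _.
have -> : N%:R * (2 * h * e0 * t * D + h ^+ 2 * D ^+ 2) =
    2 * e0 * D * t ^+ 2 + h * t * D ^+ 2 by rewrite -hN; ring.
have e1 : 2 * e0 * D <= eps ^+ 2 / 2.
  rewrite /e0 invfM mulrA; have : D / (D + 1) <= 1.
    by rewrite ler_pdivrMr ?mul1r ?lerDl// ltr_wpDl.
  have := exprn_gt0 2 eps0; nra.
have e2 : h * D ^+ 2 <= eps ^+ 2 / 2 * t.
  have : h * (2 * D ^+ 2) <= h * (eps ^+ 2 * N%:R) by rewrite ler_wpM2l.
  by rewrite -hN; lra.
have : 2 * e0 * D * t ^+ 2 <= eps ^+ 2 / 2 * t ^+ 2 by rewrite ler_wpM2r ?sqr_ge0.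
have : h * D ^+ 2 * t <= eps ^+ 2 / 2 * t * t by rewrite ler_wpM2r.
by rewrite exprMn; lra.
Qed.

End TangentApproach.

(** * Clarke normal cones *)

Section ConvexCones.
Context {R : realType} {p : nat}.
Implicit Types (A K C : set 'rV[R]_p) (u v z d : 'rV[R]_p).

Definition convex_cone K : Prop :=
  [/\ K 0, forall u v, K u -> K v -> K (u + v)
    & forall (a : R) u, 0 <= a -> K u -> K (a *: u)].

Lemma closure_seqP A u : closure A u <->
  exists s : nat -> 'rV[R]_p, (forall k, A (s k)) /\ s @ \oo --> u.
Proof.
split=> [Au|[s [As su]]].
  have /choice[s hs] (k : nat) : exists v, A v /\ `|v - u| <= k.+1%:R^-1.
    have [|v [Av]] := Au (ball u k.+1%:R^-1).
      by apply: nbhsx_ballx; rewrite invr_gt0.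
    by rewrite -ball_normE /= distrC => /ltW; exists v.
  exists s; split => [k|]; first by have [] := hs k.
  by apply: cvg_seq_harmonic => k; have [] := hs k.
apply: (@closed_cvg _ _ \oo _ s (closure A)) => //; first exact: closed_closure.
by exists 0%N => // k _; exact: subset_closure.
Qed.

Lemma convex_cone_closure K : convex_cone K -> convex_cone (closure K).
Proof.
move=> [K0 KD KZ]; split; first exact: subset_closure.
  move=> u v /closure_seqP[s [Ks su]] /closure_seqP[s' [Ks' sv]].
  apply/closure_seqP; exists (fun k => s k + s' k); split; first by move=> k; exact: KD.
  exact: cvgD.
move=> a u a0 /closure_seqP[s [Ks su]].
apply/closure_seqP; exists (fun k => a *: s k); split; first by move=> k; exact: KZ.
by apply: cvgZ => //; exact: cvg_cst.
Qed.

Lemma convex_hull_convex A : convex_set (convex_hull A).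
Proof.
move=> u v l; rewrite !inE => Au Av B [cB AB].
have := cB u v l; rewrite !inE; apply; [exact: Au | exact: Av].
Qed.

Lemma convex_cone_hull A : A 0 ->
  (forall (a : R) u, 0 <= a -> A u -> A (a *: u)) -> convex_cone (convex_hull A).
Proof.
move=> A0 AZ.
have hZ (a : R) u : 0 <= a -> convex_hull A u -> convex_hull A (a *: u).
  move=> a0; apply: (@smallest_sub _ _ _ [set v | convex_hull A (a *: v)]).
    move=> x y l; rewrite !inE /= => hx hy.
    have := @convex_hull_convex A (a *: x) (a *: y) l; rewrite !inE => /(_ hx hy).
    rewrite /conv /=; congr (convex_hull A _).
    by rewrite scalerDr !scalerA ![a * _]mulrC.
  by move=> v Av /=; apply: sub_gen_smallest; exact: AZ.
split; [exact: sub_gen_smallest | | exact: hZ].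
move=> u v hu hv.
have h01 : 0 <= 2^-1 :> R by lra.
have h11 : 2^-1 <= 1 :> R by lra.
have := @convex_hull_convex A (2 *: u) (2 *: v) (Itv01 h01 h11).
rewrite !inE => /(_ (hZ 2 u _ hu) (hZ 2 v _ hv)).
rewrite /conv /= !scalerA mulVf// scale1r.
have -> : unstable.onem 2^-1 * 2 = 1 :> R by rewrite /unstable.onem; lra.
by rewrite scale1r; apply; lra.
Qed.

Lemma dotv_le0_convex_hull A d :
  (forall u, A u -> dotv u d <= 0) -> forall u, convex_hull A u -> dotv u d <= 0.
Proof.
move=> Ad u; apply: (@smallest_sub _ _ _ [set v | dotv v d <= 0]) => // x y l.
rewrite !inE /= /conv /= dotvDl !dotvZl => hx hy.
rewrite -[0](addr0 0) lerD// mulr_ge0_le0//.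
by rewrite subr_ge0.
Qed.

Lemma dotv_le0_closure A d :
  (forall u, A u -> dotv u d <= 0) -> forall u, closure A u -> dotv u d <= 0.
Proof.
move=> Ad u /closure_seqP[s [As su]].
apply: (@closed_cvg _ _ \oo _ (fun k => dotv (s k) d) (fun x => x <= 0)).
- exact: closed_le.
- by exists 0%N => // k _; exact: Ad.
- by apply: cvg_dotv su _; exact: cvg_cst.
Qed.

Lemma limiting_normal0 C z : C z -> limiting_normal C z 0.
Proof.
move=> Cz; exists (fun=> z), (fun=> 0); split => //; [exact: cvg_cst| exact: cvg_cst|].
move=> k; split=> // e e0; near=> z' => _.
by rewrite dotv0l mulr_ge0 ?enorm_ge0// ltW.
Unshelve. all: by end_near. Qed.

Lemma limiting_normalZ C z (a : R) u :
  0 <= a -> limiting_normal C z u -> limiting_normal C z (a *: u).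
Proof.
move=> a0 [w [s [Cw wz su ws]]]; exists w, (fun k => a *: s k); split => //.
  by apply: cvgZ => //; exact: cvg_cst.
move=> k; have [_ h] := ws k; split => // e e0.
have d0 : 0 < e / (a + 1) by rewrite divr_gt0// ltr_wpDl.
apply: filterS (h _ d0) => z' h' /h'.
rewrite dotvZl mulrAC ler_pdivlMr ?ltr_wpDl// => le.
have := enorm_ge0 (z' - w k); move: le; move: (dotv _ _) (enorm _) => D E le E0.
have [D0|D0] := leP 0 D; first by nra.
by apply: (@le_trans _ _ 0); nra.
Qed.

Lemma clarke_normal_convex_cone C z : C z -> convex_cone (clarke_normal C z).
Proof.
move=> Cz; apply/convex_cone_closure/convex_cone_hull.
  exact: limiting_normal0.
by move=> a u; exact: limiting_normalZ.
Qed.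

Lemma limiting_normal_clarke C z u : limiting_normal C z u -> clarke_normal C z u.
Proof. by move=> h; apply: subset_closure; exact: sub_gen_smallest. Qed.

Lemma limiting_normal_regular_tangent C z u d :
  limiting_normal C z u -> regular_tangent C z d -> dotv u d <= 0.
Proof.
move=> [w [s [Cw wz su ws]]] [Cz td].
have D0 : 0 < enorm d + 1 by rewrite ltr_wpDl// enorm_ge0.
have D2 : 0 < enorm d + 2 by have := enorm_ge0 d; lra.
(* The steps [t k] are short enough for the estimate defining the regular
   normal [s k] to hold on the ball of radius [t k * (|d| + 1)]. *)
have /choice[t ht] (k : nat) : exists t : R, [/\ 0 < t, t <= k.+1%:R^-1 &
    forall z', `|z' - w k| <= t * (enorm d + 1) -> C z' ->
      dotv (s k) (z' - w k) <= k.+1%:R^-1 * enorm (z' - w k)].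
  have [_ /(_ k.+1%:R^-1)] := ws k; rewrite invr_gt0 => /(_ (ltr0Sn _ _)).
  move=> /nbhs_ballP[r /= r0 hr].
  exists (Num.min k.+1%:R^-1 (r / (enorm d + 2))); split.
  - by rewrite lt_min invr_gt0 ltr0n divr_gt0.
  - by rewrite ge_min lexx.
  - move=> z' h Cz'; apply: hr => //; rewrite -ball_normE /= distrC.
    apply: le_lt_trans h _.
    apply: (@le_lt_trans _ _ (r / (enorm d + 2) * (enorm d + 1))).
      by rewrite ler_wpM2r ?(ltW D0)// ge_min lexx orbT.
    by rewrite mulrAC ltr_pdivrMr// ltr_pM2l// ltrD2l ltr1n.
have t0 k : 0 < t k by have [] := ht k.
have tc : t @ \oo --> (0 : R).
  apply: (@cvg_seq_harmonic R R^o) => k; rewrite subr0 gtr0_norm//.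
  by have [] := ht k.
have [v [Cv vz vd]] := td t w t0 tc Cw wz.
pose g k := (t k)^-1 *: (v k - w k).
have gd : (fun k => enorm (g k)) @ \oo --> enorm d by exact: cvg_enorm.
have sg : (fun k => dotv (s k) (g k)) @ \oo --> dotv u d by exact: cvg_dotv.
have hg : (fun k => dotv (s k) (g k) - k.+1%:R^-1 * enorm (g k)) @ \oo --> dotv u d.
  rewrite -[dotv u d]subr0 -[0](mul0r (enorm d)); apply: cvgB => //.
  by apply: cvgM => //; exact: cvg_harmonic.
apply: (@closed_cvg _ _ \oo _ (fun k => dotv (s k) (g k) - k.+1%:R^-1 * enorm (g k))
  (fun x => x <= 0)); [exact: closed_le | | exact: hg].
have : \forall k \near \oo, enorm (g k) < enorm d + 1.
  by apply: cvgr_lt gd _ _; rewrite ltrDl.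
apply: filterS => k gk; rewrite subr_le0 /g dotvZr enormZ gtr0_norm ?invr_gt0//.
rewrite mulrCA ler_pM2l ?invr_gt0//; have [_ _] := ht k; apply => //.
apply: le_trans (norm_le_enorm _) _.
by move: gk; rewrite /g enormZ gtr0_norm ?invr_gt0// ltr_pdivrMl// => /ltW.
Qed.

Lemma clarke_normal_regular_tangent C z u d :
  clarke_normal C z u -> regular_tangent C z d -> dotv u d <= 0.
Proof.
move=> nu td; move: u nu; apply: dotv_le0_closure; apply: dotv_le0_convex_hull.
by move=> u /limiting_normal_regular_tangent; exact.
Qed.

End ConvexCones.

(** * Conic duality *)

Section ConicDuality.
Context {R : realType}.

Lemma norm_dotv_le n (u v : 'rV[R]_n) : `|dotv u v| <= enorm u * enorm v.
Proof. by rewrite ler_norml lerNl -dotvNl -{1}(enormN u) !dotv_le. Qed.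

Lemma mulmx_bound p q (B : 'M[R]_(p, q)) :
  exists c : R, 0 <= c /\ forall u : 'rV[R]_p, `|u *m B| <= c * `|u|.
Proof.
exists (\sum_j p%:R * enorm (col j B)^T); split.
  by apply: sumr_ge0 => j _; rewrite mulr_ge0// enorm_ge0.
move=> u; apply: mx_norm_leP.
  by rewrite mulr_ge0// sumr_ge0// => j _; rewrite mulr_ge0// enorm_ge0.
move=> j; have -> : (u *m B) 0 j = dotv u (col j B)^T.
  by rewrite dotvE mxE; apply: eq_bigr => i _; rewrite !mxE.
apply: le_trans (norm_dotv_le _ _) _.
apply: (@le_trans _ _ (p%:R * `|u| * enorm (col j B)^T)).
  by rewrite ler_wpM2r ?enorm_ge0// enorm_le_norm.
rewrite mulrAC ler_wpM2r// (bigD1 j)//= lerDl.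
by apply: sumr_ge0 => i _; rewrite mulr_ge0// enorm_ge0.
Qed.

Lemma cvg_mulmx p q (B : 'M[R]_(p, q)) (s : nat -> 'rV[R]_p) (u : 'rV[R]_p) :
  s @ \oo --> u -> (fun k => s k *m B) @ \oo --> u *m B.
Proof.
move=> su; have [c [c0 hc]] := mulmx_bound B; apply/cvg_seqP => e e0.
have c1 : 0 < c + 1 by rewrite ltr_wpDl.
have /cvg_seqP/(_ (e / (c + 1))) [|N hN] := su; first exact: divr_gt0.
exists N => k /hN; rewrite ltr_pdivlMr// -mulmxBl => h.
apply: le_lt_trans h; apply: le_trans (hc _) _.
by rewrite mulrC ler_wpM2l// lerDl.
Qed.

Section Image.
Variables (p q : nat) (K : set 'rV[R]_p) (B : 'M[R]_(p, q)).
Hypotheses (K_closed : closed K) (K_cone : convex_cone K).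
Hypothesis K_ker : forall l, K l -> l *m B = 0 -> l = 0.

Lemma cone_image_bound : exists c : R, forall l, K l -> `|l| <= c * `|l *m B|.
Proof.
have [_ _ KZ] := K_cone.
apply: contrapT => /forallNP H.
have /choice[nu hnu] (k : nat) : exists nu : 'rV[R]_p,
    [/\ K nu, `|nu| = 1 & `|nu *m B - 0| <= k.+1%:R^-1].
  have /existsNP[l /not_implyP[Kl /negP]] := H k.+1%:R.
  rewrite -ltNge => lB.
  have l0 : 0 < `|l| by apply: le_lt_trans lB; rewrite mulr_ge0.
  exists (`|l|^-1 *: l); split.
  - by apply: KZ => //; rewrite invr_ge0.
  - by rewrite normrZ gtr0_norm ?invr_gt0// mulVf// gt_eqF.
  - rewrite subr0 -scalemxAl normrZ gtr0_norm ?invr_gt0// ler_pdivrMl//.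
    by rewrite mulrC ler_pdivlMl// ltW.
have [|phi [l [kphi nul]]] := @bounded_subseq R p nu 1.
  by move=> k; have [_ ->] := hnu k.
have Kl : K l.
  apply: (@closed_cvg _ _ \oo _ (fun k => nu (phi k)) K) => //.
  by exists 0%N => // k _; have [] := hnu (phi k).
have l1 : `|l| = 1.
  have h : (fun k => `|nu (phi k)|) @ \oo --> `|l| by exact: cvg_norm.
  apply: (@cvg_unique R^o _ _ _ _ _ h) => //.
  have -> : (fun k => `|nu (phi k)|) = fun=> 1.
    by apply/funext => k; have [_ ->] := hnu (phi k).
  exact: cvg_cst.
have lB : l *m B = 0.
  apply: (@cvg_unique 'rV[R]_q _ _ _ _ _ (cvg_mulmx (B := B) nul)) => //.
  apply: (@cvg_comp_subseq _ (fun k => nu k *m B)) => //.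
  by apply: cvg_seq_harmonic => k; have [] := hnu k.
by move: l1; rewrite (K_ker Kl lB) normr0 => /eqP; rewrite eq_sym oner_eq0.
Qed.

Lemma closed_cone_image : closed [set l *m B | l in K].
Proof.
move=> b /closure_seqP[s [Ks sb]]; have [c hc] := cone_image_bound.
have /choice[l hl] (k : nat) : exists l, K l /\ l *m B = s k.
  by have [l Kl <-] := Ks k; exists l.
have [M hM] : exists M, forall k, `|s k| <= M.
  have [M [_ hM]] := cvg_seq_bounded (cvgP _ sb).
  by exists (M + 1) => k; apply: hM => //; rewrite ltrDl.
have [|phi [l' [kphi ll']]] := @bounded_subseq R p l (`|c| * M).
  move=> k; have [Kl e] := hl k; apply: le_trans (hc _ Kl) _; rewrite e.
  apply: (@le_trans _ _ (`|c| * `|s k|)); first by rewrite ler_wpM2r// ler_norm.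
  by rewrite ler_wpM2l.
exists l'.
  apply: (@closed_cvg _ _ \oo _ (fun k => l (phi k)) K) => //.
  by exists 0%N => // k _; have [] := hl (phi k).
apply: (@cvg_unique 'rV[R]_q _ _ _ _ _ (cvg_mulmx (B := B) ll')) => //.
have -> : (fun k => l (phi k) *m B) = s \o phi.
  by apply/funext => k /=; have [] := hl (phi k).
exact: cvg_comp_subseq sb.
Qed.

Lemma quadratic_le0 (x y : R) :
  (forall s, 0 < s -> s <= 1 -> s * x <= s ^+ 2 * y) -> x <= 0.
Proof.
move=> h; rewrite leNgt; apply/negP => x0.
pose s := x / (x + `|y| + 1).
have y0 := normr_ge0 y; have d0 : 0 < x + `|y| + 1 by lra.
have s0 : 0 < s by exact: divr_gt0.
have s1 : s <= 1 by rewrite ler_pdivrMr// mul1r; lra.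
have := h s s0 s1; rewrite expr2 -mulrA ler_pM2l// => xsy.
have : s * y <= s * `|y| by rewrite ler_pM2l// ler_norm.
have : s * (x + `|y| + 1) = x by rewrite /s divfK// gt_eqF.
have : 0 < s * x by exact: mulr_gt0.
lra.
Qed.

Lemma farkas (a : 'rV[R]_q) :
  (forall v, (forall l, K l -> dotv (l *m B) v <= 0) -> dotv a v <= 0) ->
  exists l, K l /\ l *m B = a.
Proof.
have [K0 KD KZ] := K_cone.
move=> h; have [] := closed_projection a closed_cone_image.
  by exists 0; exists 0; rewrite ?mul0mx.
move=> _ [[l Kl <-] /sqr_projection hw]; exists l; split => //.
have Kw l' s : K l' -> 0 < s -> s <= 1 ->
    s * (2 * dotv (a - l *m B) (l' *m B)) <= s ^+ 2 * enorm (l' *m B) ^+ 2.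
  move=> Kl' s0 s1; have := hw ((l + s *: l') *m B).
  rewrite mulmxDl (addrC (l *m B)) addrK -scalemxAl dotvZr enormZ exprMn.
  rewrite real_normK ?num_real// mulrCA; apply.
  exists (l + s *: l'); first by apply: KD => //; apply: KZ => //; exact: ltW.
  by rewrite mulmxDl -scalemxAl addrC.
have lw s : 0 < s -> s <= 1 ->
    s * (2 * - dotv (a - l *m B) (l *m B)) <= s ^+ 2 * enorm (l *m B) ^+ 2.
  move=> s0 s1; have := hw (((1 - s) *: l) *m B).
  rewrite -scalemxAl scalerBl scale1r addrAC subrr add0r enormN dotvNr dotvZr.
  rewrite enormZ exprMn real_normK ?num_real// -mulrN mulrCA; apply.
  exists ((1 - s) *: l); first by apply: KZ => //; rewrite subr_ge0.
  by rewrite -scalemxAl scalerBl scale1r.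
have /h : forall l', K l' -> dotv (l' *m B) (a - l *m B) <= 0.
  move=> l' Kl'; have := quadratic_le0 (fun s => @Kw l' s Kl').
  by rewrite dotvC; lra.
have := quadratic_le0 lw; move: (dotvv_ge0 (a - l *m B)).
have -> : dotv a (a - l *m B) =
    dotv (a - l *m B) (a - l *m B) + dotv (a - l *m B) (l *m B).
  by rewrite -dotvDr subrK dotvC.
move=> r0 rl ra; apply/esym/eqP; rewrite -subr_eq0 -enorm_eq0 -sqrf_eq0 sqr_enorm.
by rewrite eq_le r0 andbT; lra.
Qed.

End Image.

Lemma dotv_row_mx p q (u1 v1 : 'rV[R]_p) (u2 v2 : 'rV[R]_q) :
  dotv (row_mx u1 u2) (row_mx v1 v2) = dotv u1 v1 + dotv u2 v2.
Proof. by rewrite /dotv tr_row_mx mul_row_col mxE. Qed.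

Lemma dotv_mulmx p q (l : 'rV[R]_p) (B : 'M[R]_(p, q)) (v : 'rV[R]_q) :
  dotv (l *m B) v = dotv l (v *m B^T).
Proof. by rewrite /dotv trmx_mul trmxK mulmxA. Qed.

(* Farkas' lemma is applied to [K * R_+] and the map
   [(l, r) |-> (l *m B, dotv l b - r)], which misses [(- a, M + e)]. *)
Lemma conic_duality p q (K : set 'rV[R]_p) (B : 'M[R]_(p, q))
    (a : 'rV[R]_q) (b : 'rV[R]_p) (M e : R) :
  closed K -> convex_cone K ->
  (forall l, K l -> l *m B = 0 -> l = 0) ->
  (exists l, K l /\ a + l *m B = 0) ->
  (forall l, K l -> a + l *m B = 0 -> dotv l b <= M) ->
  0 < e ->
  exists v, (forall l, K l -> dotv l (b + v *m B^T) <= 0) /\ dotv a v <= M + e.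
Proof.
move=> Kcl Kc Kker [l0 [Kl0 al0]] hM e0; have [K0 KD KZ] := Kc.
pose K' : set 'rV[R]_(p + 1) := [set l | K (lsubmx l) /\ 0 <= rsubmx l 0 0].
pose B' : 'M[R]_(p + 1, q + 1) := block_mx B b^T 0 (- 1%:M).
have lE (l : 'rV[R]_(p + 1)) : l *m B' =
    row_mx (lsubmx l *m B) ((dotv (lsubmx l) b - rsubmx l 0 0)%:M).
  rewrite -{1}[l]hsubmxK /B' mul_row_block mulmx0 addr0 mulmxN mulmx1; congr row_mx.
  by apply/rowP => i; rewrite !ord1 /dotv !mxE /= mulr1n.
have K'cl : closed K'.
  move=> l /closure_seqP[s [Ks sl]]; split.
    have Le (u : 'rV[R]_(p + 1)) : lsubmx u = u *m col_mx 1%:M 0.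
      by rewrite -{2}[u]hsubmxK mul_row_col mulmx1 mulmx0 addr0.
    rewrite Le; apply: (@closed_cvg _ _ \oo _ (fun k => s k *m col_mx 1%:M 0) K) => //.
      by exists 0%N => // k _; rewrite -Le; have [] := Ks k.
    exact: cvg_mulmx.
  rewrite mxE; apply: (@closed_cvg _ _ \oo _ (fun k => s k 0 (rshift p 0)) (fun x => 0 <= x)).
  - exact: closed_ge.
  - by exists 0%N => // k _; have [_] := Ks k; rewrite mxE.
  - exact: cvg_coord.
have K'c : convex_cone K'.
  split; first by split; rewrite ?linear0 ?mxE.
    move=> u v [Ku u0] [Kv v0]; split; first by rewrite linearD; exact: KD.
    by rewrite linearD mxE addr_ge0.
  move=> s u s0 [Ku u0]; split; first by rewrite linearZ; exact: KZ.
  by rewrite linearZ mxE mulr_ge0.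
have K'ker l : K' l -> l *m B' = 0 -> l = 0.
  move=> [Kl r0]; rewrite lE -(row_mx0) => /eq_row_mx[/(Kker _ Kl) L0].
  rewrite L0 dotv0l sub0r => /matrixP/(_ 0 0); rewrite !mxE mulr1n => /eqP.
  rewrite oppr_eq0 => /eqP rl; rewrite -[l]hsubmxK L0 -(row_mx0); congr row_mx.
  by apply/rowP => i; rewrite ord1 !mxE.
have [/(farkas K'cl K'c K'ker)|] := pselect (forall v, (forall l, K' l ->
    dotv (l *m B') v <= 0) -> dotv (row_mx (- a) (M + e)%:M) v <= 0).
  move=> [l [[Kl r0]]]; rewrite lE => /eq_row_mx[lB /matrixP/(_ 0 0)].
  rewrite !mxE !mulr1n => lb; have := hM _ Kl; rewrite lB addrN => /(_ erefl).
  by move: r0 lb; rewrite mxE; lra.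
move=> /existsNP[v' /not_implyP[hv' /negP]]; rewrite -ltNge.
rewrite -[v']hsubmxK dotv_row_mx dotvNl; set v := lsubmx v'.
set t := rsubmx v' 0 0.
have tE (x : R) : dotv x%:M (rsubmx v') = x * t.
  by rewrite dotvE big_ord1 /t mxE eqxx mulr1n.
rewrite tE => av.
have hKv l r : K l -> 0 <= r -> dotv (l *m B) v + (dotv l b - r) * t <= 0.
  move=> Kl r0; have := hv' (row_mx l r%:M); rewrite lE row_mxKl row_mxKr.
  rewrite -[v']hsubmxK dotv_row_mx tE mxE mulr1n; apply.
  by rewrite /K' /= row_mxKl row_mxKr mxE mulr1n.
have t0 : 0 <= t.
  by have := hKv 0 1 K0 ler01; rewrite mul0mx !dotv0l; lra.
have [t00|tn0] := eqVneq t 0.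
  have := hKv l0 0 Kl0 (lexx 0); rewrite t00 mulr0 addr0.
  have -> : l0 *m B = - a by apply/eqP; rewrite -addr_eq0 addrC al0.
  by move: av; rewrite t00 mulr0 addr0 dotvNl; lra.
have tp : 0 < t by rewrite lt_def tn0.
exists (t^-1 *: v); split.
  move=> l Kl; have := hKv l 0 Kl (lexx 0); rewrite subr0 dotv_mulmx => h.
  rewrite dotvDr -scalemxAl dotvZr -(pmulr_rle0 _ tp) mulrDr mulVKf//.
  by rewrite addrC mulrC.
by rewrite dotvZr ler_pdivrMl//; lra.
Qed.

End ConicDuality.

(** * Strict differentiability *)

Section StrictDifferentiability.
Context {R : realType}.

Section Scalar.
Context {V : normedModType R}.

Lemma is_derive_line (g : V -> R^o) (z h : V) (s : R) :
  differentiable g (z + s *: h) ->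
  is_derive s 1 (fun s : R => g (z + s *: h) : R^o) ('d g (z + s *: h) h).
Proof.
move=> dg.
have E : (fun k : R => k^-1 *: (((fun s : R => g (z + s *: h) : R^o) \o shift s)
      (k *: (1 : R^o)) - g (z + s *: h))) =
    (fun k : R => k^-1 *: ((g \o shift (z + s *: h)) (k *: h) - g (z + s *: h))).
  apply/funext => k /=; congr (_ *: (g _ - _)).
  by rewrite [k *: 1]mulr1 scalerDl addrCA.
split; first by rewrite /derivable E; exact: diff_derivable.
by rewrite /derive E -deriveE.
Qed.

Lemma C1_directional_scalar (g : V -> R) (z h : V) (e : R) :
  C1 (g : V -> R^o) -> 0 < e -> exists r : R, 0 < r /\
  forall z' h' t, `|z' - z| < r -> `|h' - h| < r -> 0 < t -> t < r ->
    `|g (z' + t *: h') - g z' - t * 'd (g : V -> R^o) z h| <= e * t.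
Proof.
move=> [dg cg] e0; pose A := `|h| + 1.
have A0 : 0 < A by rewrite ltr_wpDl.
have eA : 0 < e / 2 / A by rewrite !divr_gt0.
have /nbhs_ballP[r1 /= r10 hr1] := cg z _ eA.
have [c c0 hc] := @linear_lipschitz R V R^o ('d (g : V -> R^o) z) (diff_continuous (dg z)).
pose r := Num.min 1 (Num.min (r1 / (1 + A)) (e / 2 / c)).
have r0 : 0 < r by rewrite !lt_min ltr01 !divr_gt0// addr_gt0.
exists r; split=> // z' h' t zz hh t0 tr.
have r_le1 : r <= 1 by rewrite ge_min lexx.
have r_ler1 : r <= r1 / (1 + A) by rewrite !ge_min lexx orbT.
have r_lec : r <= e / 2 / c by rewrite !ge_min lexx !orbT.
have h'A : `|h'| <= A.
  rewrite -(subrK h h') (le_trans (ler_normD _ _))// addrC lerD2l.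
  exact/ltW/(lt_le_trans hh).
have der (s : R) : is_derive s 1 (fun s : R => g (z' + s *: h') : R^o)
    ('d (g : V -> R^o) (z' + s *: h') h').
  exact/is_derive_line/dg.
have [|s] := @MVT R (fun s => g (z' + s *: h'))
    (fun s => 'd (g : V -> R^o) (z' + s *: h') h') 0 t t0.
  apply: continuous_subspaceT => s; apply: differentiable_continuous.
  by apply/derivable1_diffP; have [] := der s.
rewrite in_itv /= subr0 scale0r addr0 => /andP[s0 st] ->.
rewrite mulrC -mulrBr normrM gtr0_norm// mulrC ler_pM2r//.
have zs : ball z r1 (z' + s *: h').
  rewrite -ball_normE /= opprD addrA; apply: le_lt_trans (ler_normB _ _) _.
  rewrite distrC normrZ gtr0_norm//.
  have : s * `|h'| <= t * A by rewrite ler_pM// ltW.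
  have : t * A < r * A by rewrite ltr_pM2r.
  have : r * (1 + A) <= r1 by rewrite -ler_pdivlMr// addr_gt0.
  by lra.
have := hr1 _ zs h'; set D := 'd _ (z' + s *: h') h' => d1.
have d2 := hc (h' - h).
have -> : D - 'd (g : V -> R^o) z h =
    (D - 'd (g : V -> R^o) z h') + 'd (g : V -> R^o) z (h' - h).
  by rewrite linearB /= addrA subrK.
apply: le_trans (ler_normD _ _) _.
have h1 : e / 2 / A * `|h'| <= e / 2.
  by rewrite mulrAC ler_pdivrMr// ler_wpM2l// divr_ge0 ?ltW.
have h2 : c * `|h' - h| <= e / 2 by rewrite mulrC -ler_pdivlMr// ltW// (lt_le_trans hh).
have := le_trans d1 h1; have := le_trans d2 h2; lra.
Qed.

End Scalar.
Section Vector.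
Context {V : normedModType R} {p : nat}.
Implicit Types F : V -> 'rV[R]_p.

Lemma differentiable_mx_coord F z i :
  differentiable F z -> differentiable (fun z => F z 0 i : R^o) z.
Proof.
move=> dF; apply: (@differentiable_comp _ _ _ _ F (fun N : 'rV[R]_p => N 0 i : R^o)) => //.
exact: differentiable_coord.
Qed.

Lemma diff_mx_coord F z i h : differentiable F z ->
  'd (fun z => F z 0 i : R^o) z h = 'd F z h 0 i.
Proof.
move=> dF; rewrite -!deriveE//; last exact: differentiable_mx_coord.
rewrite derive_mx ?mxE//; exact: diff_derivable.
Qed.

Lemma C1_mx_coord F i : C1 F -> C1 (fun z => F z 0 i : R^o).
Proof.
move=> [dF cF]; split; first by move=> z; exact: differentiable_mx_coord.
move=> z e e0; apply: filterS (cF z e e0) => z' h k.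
rewrite !diff_mx_coord//; apply: le_trans (h k).
by have := mx_coord_le ('d F z' k - 'd F z k) i; rewrite !mxE.
Qed.

Lemma uniform_radius (n : nat) (Q : 'I_n -> R -> Prop) :
  (forall i (r s : R), 0 < s -> s <= r -> Q i r -> Q i s) ->
  (forall i, exists r : R, 0 < r /\ Q i r) -> exists r : R, 0 < r /\ forall i, Q i r.
Proof.
move=> Qle /choice[r hr]; exists (\big[Num.min/1]_i r i).
have r0 : 0 < \big[Num.min/1]_i r i.
  by apply/bigmin_gtP; split => // i _; have [] := hr i.
split=> // i; have [ri Qi] := hr i; apply: Qle Qi => //.
exact: bigmin_le_cond.
Qed.

Lemma C1_directional F (z h : V) (e : R) :
  C1 F -> 0 < e -> exists r : R, 0 < r /\
  forall z' h' t, `|z' - z| < r -> `|h' - h| < r -> 0 < t -> t < r ->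
    `|F (z' + t *: h') - F z' - t *: 'd F z h| <= e * t.
Proof.
move=> cF e0.
pose Q i r := forall z' h' t, `|z' - z| < r -> `|h' - h| < r -> 0 < t -> t < r ->
    `|F (z' + t *: h') 0 i - F z' 0 i - t * 'd F z h 0 i| <= e * t.
have [i r s _ sr Qr z' h' t hz hh t0 ts|i|r [r0 hr]] := @uniform_radius p Q.
- by apply: Qr => //; exact: lt_le_trans sr.
- have [r [r0 hr]] := C1_directional_scalar z h (C1_mx_coord i cF) e0.
  exists r; split=> // z' h' t hz hh t0 tr; have := hr _ _ _ hz hh t0 tr.
  by rewrite diff_mx_coord//; have [] := cF.
exists r; split=> // z' h' t hz hh t0 tr; apply: mx_norm_leP.
  by rewrite mulr_ge0// ltW.
by move=> i; have := hr i _ _ _ hz hh t0 tr; rewrite !mxE.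
Qed.

End Vector.
End StrictDifferentiability.

Section PartialDerivatives.
Context {R : realType} {n m : nat}.
Implicit Types (x u : 'rV[R]_n) (y v : 'rV[R]_m).

Lemma is_diff_fst_slice (W : normedModType R) (g : 'rV[R]_n * 'rV[R]_m -> W) x y :
  differentiable g (x, y) ->
  is_diff x (fun x' => g (x', y)) (fun u => 'd g (x, y) (u, 0)).
Proof.
move=> dg; have h : is_diff x (fun x' => (x', y)) (fun u => (u, 0)).
  exact: (@is_diff_pair _ _ _ _ id id (cst y) 0 x (is_diff_id x) (is_diff_cst y x)).
have [dh eh] := h; split.
  exact: (@differentiable_comp _ _ _ _ (fun x' => (x', y)) g).
rewrite (@diff_comp _ _ _ _ (fun x' => (x', y)) g)//.
by rewrite eh.
Qed.

Lemma is_diff_snd_slice (W : normedModType R) (g : 'rV[R]_n * 'rV[R]_m -> W) x y :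
  differentiable g (x, y) ->
  is_diff y (fun y' => g (x, y')) (fun v => 'd g (x, y) (0, v)).
Proof.
move=> dg; have h : is_diff y (fun y' => (x, y')) (fun v => (0, v)).
  exact: (@is_diff_pair _ _ _ _ (cst x) 0 id id y (is_diff_cst x y) (is_diff_id y)).
have [dh eh] := h; split.
  exact: (@differentiable_comp _ _ _ _ (fun y' => (x, y')) g).
rewrite (@diff_comp _ _ _ _ (fun y' => (x, y')) g)//.
by rewrite eh.
Qed.

Lemma dotv_grad k (g : 'rV[R]_k -> R) (z w : 'rV[R]_k) :
  dotv (grad g z) w = 'd (g : 'rV[R]_k -> R^o) z w.
Proof.
rewrite {2}[w]row_sum_delta linear_sum dotvE; apply: eq_bigr => i _.
by rewrite linearZ mxE mulrC.
Qed.

Lemma mulmx_Jac k p (g : 'rV[R]_k -> 'rV[R]_p) (z w : 'rV[R]_k) :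
  w *m (Jac g z)^T = 'd g z w.
Proof. by rewrite /Jac trmxK /jacobian mul_rV_lin1. Qed.

Lemma derPE p (P : 'rV[R]_n * 'rV[R]_m -> 'rV[R]_p) x y u v :
  differentiable P (x, y) -> derP P x y u v = 'd P (x, y) (u, v).
Proof.
move=> dP; rewrite /derP /JacxP /JacyP !mulmx_Jac.
have [_ ->] := is_diff_fst_slice dP; have [_ ->] := is_diff_snd_slice dP.
by rewrite -linearD; congr ('d P (x, y) _); rewrite /GRing.add /= /add_pair /= addr0 add0r.
Qed.

End PartialDerivatives.

(** * Feasible displacements and multipliers *)

Section Steps.
Context {R : realType} {n m p : nat}.
Variables (f : 'rV[R]_n * 'rV[R]_m -> R) (P : 'rV[R]_n * 'rV[R]_m -> 'rV[R]_p).
Variable C : set 'rV[R]_p.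
Hypothesis f_C1 : C1 (f : 'rV[R]_n * 'rV[R]_m -> R^o).
Hypothesis P_C1 : C1 P.
Hypothesis C_closed : closed C.

Lemma dir_nbhd0 (e d : R) (u : 'rV[R]_n) : 0 < e -> dir_nbhd e d u 0.
Proof.
move=> e0; rewrite /dir_nbhd; case: ifP => _ /=; first by rewrite enorm0.
by left.
Qed.

Lemma dir_nbhd_cone (e d : R) (u : 'rV[R]_n) : 0 < e -> 0 < d ->
  exists r : R, 0 < r /\ forall t u', `|u' - u| < r -> 0 < t -> t < r ->
    dir_nbhd e d u (t *: u').
Proof.
move=> e0 d0.
have FF : Filter (nbhs (u : 'rV[R]_n)) by exact: nbhs_filter.
have enc : (fun u' : 'rV[R]_n => enorm u') @ nbhs u --> enorm u.
  exact: (@cvg_enorm _ _ _ _ FF (fun w => w) _ cvg_id).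
have D0 : 0 < enorm u + 1 by rewrite ltr_wpDl// enorm_ge0.
have n1 : \forall u' \near u, enorm u' < enorm u + 1.
  by apply: cvgr_lt enc _ _; rewrite ltrDl.
have [u0|u0] := eqVneq u 0.
  have [r /= r0 hr] := (@nbhs_ballP R 'rV[R]_n u _).1 n1.
  exists (Num.min r (e / (enorm u + 1))); split; first by rewrite lt_min r0 divr_gt0.
  move=> t u' uu t0; rewrite lt_min => /andP[_]; rewrite ltr_pdivlMr// => te.
  move: uu; rewrite lt_min => /andP[uu _]; rewrite /dir_nbhd u0 eqxx /=.
  rewrite enormZ gtr0_norm//; apply: lt_trans te; rewrite ltr_pM2l//.
  by apply: hr; rewrite -ball_normE /= distrC.
have un : 0 < enorm u by rewrite enorm_gt0.
have n2 : \forall u' \near u, 0 < enorm u' by apply: cvgr_gt enc _ _.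
pose g (u' : 'rV[R]_n) := (enorm u')^-1 *: u' - (enorm u)^-1 *: u.
have gc : g @ nbhs u --> (0 : 'rV[R]_n).
  rewrite -(subrr ((enorm u)^-1 *: u)); apply: cvgB; last exact: cvg_cst.
  by apply: cvgZ; [apply: cvgV; rewrite ?gt_eqF | exact: cvg_id].
have n3 : \forall u' \near u, enorm (g u') < d.
  have h := @cvg_enorm _ _ _ _ FF g _ gc.
  by apply: cvgr_lt h _ _; rewrite enorm0.
have [r /= r0 hr] := (@nbhs_ballP R 'rV[R]_n u _).1 (filterI n1 (filterI n2 n3)).
exists (Num.min r (e / (enorm u + 1))); split; first by rewrite lt_min r0 divr_gt0.
move=> t u' uu t0; rewrite lt_min => /andP[_]; rewrite ltr_pdivlMr// => te.
move: uu; rewrite lt_min => /andP[uu _].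
have [|h1 [h2 h3]] := hr u'; first by rewrite -ball_normE /= distrC.
rewrite /dir_nbhd (negbTE u0) /=; right; split.
- by rewrite enormZ gtr0_norm//; apply: lt_trans te; rewrite ltr_pM2l.
- by rewrite scaler_eq0 negb_or gt_eqF//= -enorm_gt0.
- rewrite enormZ gtr0_norm// scalerA invfM mulrAC mulVf ?gt_eqF// mul1r.
  exact: ltW.
Qed.

Lemma feasible_step x y u w v (eps : R) :
  robinson_stable P C x y u ->
  (forall l, limiting_normal C (P (x, y)) l -> dotv l ('d P (x, y) (w, v)) <= 0) ->
  0 < eps ->
  exists r e0 d0 : R, [/\ 0 < r, 0 < e0, 0 < d0 &
    forall x1 y1 w' t, `|x1 - x| < r -> `|y1 - y| < r -> `|w' - w| < r ->
      0 < t -> t < r -> feasible P C x1 y1 ->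
      dir_nbhd e0 d0 u (x1 + t *: w' - x) ->
      exists v', `|v' - v| < eps /\ feasible P C (x1 + t *: w') (y1 + t *: v')].
Proof.
move=> [Fy [kappa [e0 [d0 [k0 e00 d00 RS]]]]] polar eps0.
pose eta := eps / (kappa * (p%:R + 1) + 1).
have K0 : 0 < kappa * (p%:R + 1) + 1 by rewrite ltr_wpDl// mulr_ge0// addr_ge0.
have eta0 : 0 < eta by exact: divr_gt0.
have [r1 [r10 hr1]] := tangent_approach C_closed Fy polar eta0.
have [r2 [r20 hr2]] := C1_directional (x, y) (w, v) P_C1 eta0.
have [dP _] := P_C1.
have /cvgrPdist_lt/(_ r1 r10) := differentiable_continuous (dP (x, y)).
move=> /nbhs_ballP[r3 /= r30 hr3].
have M0 : 0 < m%:R * (1 + `|v|) + 1.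
  by rewrite ltr_wpDl// mulr_ge0// addr_ge0.
pose r4 := e0 / (m%:R * (1 + `|v|) + 1); have r40 : 0 < r4 by exact: divr_gt0.
pose r := Num.min (Num.min r1 r2) (Num.min r3 r4).
have rr1 : r <= r1 by rewrite !ge_min lexx.
have rr2 : r <= r2 by rewrite !ge_min lexx !orbT.
have rr3 : r <= r3 by rewrite !ge_min lexx !orbT.
have rr4 : r <= r4 by rewrite !ge_min lexx !orbT.
exists r, e0, d0; split => //; first by rewrite !lt_min r10 r20 r30 r40.
move=> x1 y1 w' t hx hy hw t0 tr F1 dir.
have hz s : r <= s -> `|(x1, y1) - (x, y)| < s.
  move=> rs; apply: lt_le_trans rs.
  have -> : (x1, y1) - (x, y) = (x1 - x, y1 - y) by [].
  by rewrite prod_normE /= gt_max hx hy.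
have Pz : `|P (x1, y1) - P (x, y)| < r1.
  by rewrite distrC; apply: hr3; rewrite -ball_normE /= distrC; exact: hz.
have [|c [Cc hc]] := hr1 _ t F1 Pz; first by rewrite (ltW t0) (lt_le_trans tr).
have hd := hr2 (x1, y1) (w', v) t (hz _ rr2).
have {}hd : `|P (x1 + t *: w', y1 + t *: v) - P (x1, y1) -
    t *: 'd P (x, y) (w, v)| <= eta * t.
  apply: hd => //; last exact: lt_le_trans rr2.
  have -> : (w', v) - (w, v) = (w' - w, v - v) by [].
  by rewrite subrr prod_normE /= normr0 gt_max (lt_le_trans hw rr2).
have dP1 : enorm (P (x1 + t *: w', y1 + t *: v) - c) <= (p%:R + 1) * (eta * t).
  have -> : P (x1 + t *: w', y1 + t *: v) - c =
    (P (x1 + t *: w', y1 + t *: v) - P (x1, y1) - t *: 'd P (x, y) (w, v)) -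
    (c - (P (x1, y1) + t *: 'd P (x, y) (w, v))).
    rewrite opprB addrA; congr (_ - _).
    by rewrite -[X in _ = X + _]addrA -opprD subrK.
  apply: le_trans (enormD _ _) _; rewrite enormN mulrDl mul1r lerD//.
  apply: le_trans (enorm_le_norm _) _; exact: ler_wpM2l.
have ey : enorm (y1 + t *: v - y) < e0.
  apply: le_lt_trans (enorm_le_norm _) _.
  have h1 : `|y1 + t *: v - y| <= r * (1 + `|v|).
    rewrite addrAC; apply: le_trans (ler_normD _ _) _.
    rewrite mulrDr mulr1 lerD ?(ltW hy)// normrZ gtr0_norm// ler_wpM2r// ltW//.
  have h2 : r * (m%:R * (1 + `|v|) + 1) <= e0 by rewrite -ler_pdivlMr.
  have r0 : 0 < r by rewrite !lt_min r10 r20 r30 r40.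
  have : m%:R * `|y1 + t *: v - y| <= m%:R * (r * (1 + `|v|)) by rewrite ler_wpM2l.
  lra.
have := RS _ _ dir ey => RSd.
have : (dist (y1 + t *: v) (feasible P C (x1 + t *: w')) < (eps * t)%:E)%E.
  apply: le_lt_trans RSd _.
  apply: (@le_lt_trans _ _ (kappa%:E * ((p%:R + 1) * (eta * t))%:E)%E).
    apply: lee_wpmul2l; first by rewrite lee_fin.
    apply: ge_ereal_inf; exists (enorm (P (x1 + t *: w', y1 + t *: v) - c))%:E.
      by exists c.
    by rewrite lee_fin.
  have ke : kappa * (p%:R + 1) * eta < eps.
    by rewrite /eta mulrA ltr_pdivrMr// mulrC ltr_pM2l// ltrDl.
  have : kappa * (p%:R + 1) * eta * t < eps * t by rewrite ltr_pM2r.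
  by rewrite -EFinM lte_fin; lra.
move=> /ereal_inf_lt[_ [a Fa <-]]; rewrite lte_fin => ha.
exists (t^-1 *: (a - y1)); split; last first.
  by rewrite scalerA divff ?gt_eqF// scale1r (addrC y1) subrK.
have -> : t^-1 *: (a - y1) - v = t^-1 *: - (y1 + t *: v - a).
  rewrite opprB opprD addrA [RHS]scalerDr [in RHS]scalerN [in RHS]scalerA.
  by rewrite mulVf ?gt_eqF// scale1r.
rewrite scalerN normrN normrZ gtr0_norm ?invr_gt0// ltr_pdivrMl// mulrC.
by apply: le_lt_trans ha; exact: norm_le_enorm.
Qed.

Lemma value_step x y u w v (eps : R) :
  robinson_stable P C x y u ->
  (forall l, limiting_normal C (P (x, y)) l -> dotv l ('d P (x, y) (w, v)) <= 0) ->
  0 < eps ->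
  exists r e0 d0 : R, [/\ 0 < r, 0 < e0, 0 < d0 &
    forall x1 y1 w' t, `|x1 - x| < r -> `|y1 - y| < r -> `|w' - w| < r ->
      0 < t -> t < r -> feasible P C x1 y1 ->
      dir_nbhd e0 d0 u (x1 + t *: w' - x) ->
      exists y2, feasible P C (x1 + t *: w') y2 /\
        f (x1 + t *: w', y2) <=
          f (x1, y1) + t * ('d (f : _ -> R^o) (x, y) (w, v) + eps)].
Proof.
move=> RS polar eps0.
have [r1 [r10 hr1]] := C1_directional_scalar (x, y) (w, v) f_C1 eps0.
have [r2 [e0 [d0 [r20 e00 d00 hr2]]]] := feasible_step RS polar r10.
pose r := Num.min r1 r2.
have rr1 : r <= r1 by rewrite !ge_min lexx.
have rr2 : r <= r2 by rewrite !ge_min lexx !orbT.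
exists r, e0, d0; split => //; first by rewrite lt_min r10.
move=> x1 y1 w' t hx hy hw t0 tr F1 dir.
have [|||||||v' [hv F2]] := hr2 x1 y1 w' t => //; try by apply: lt_le_trans rr2.
exists (y1 + t *: v'); split => //.
have : `|f ((x1, y1) + t *: (w', v')) - f (x1, y1) -
    t * 'd (f : _ -> R^o) (x, y) (w, v)| <= eps * t.
  apply: hr1 => //; last exact: lt_le_trans rr1.
  - have -> : (x1, y1) - (x, y) = (x1 - x, y1 - y) by [].
    by rewrite prod_normE /= gt_max !(lt_le_trans _ rr1).
  - have -> : (w', v') - (w, v) = (w' - w, v' - v) by [].
    by rewrite prod_normE /= gt_max (lt_le_trans hw rr1).
have -> : (x1, y1) + t *: (w', v') = (x1 + t *: w', y1 + t *: v') by [].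
by rewrite ler_norml => /andP[_]; lra.
Qed.

End Steps.

Section Multipliers.
Context {R : realType} {n m p : nat}.
Variables (f : 'rV[R]_n * 'rV[R]_m -> R) (P : 'rV[R]_n * 'rV[R]_m -> 'rV[R]_p).
Variable C : set 'rV[R]_p.
Hypothesis f_C1 : C1 (f : 'rV[R]_n * 'rV[R]_m -> R^o).
Hypothesis P_C1 : C1 P.
Hypothesis C_closed : closed C.

Let df : forall z, differentiable (f : _ -> R^o) z. Proof. by have [] := f_C1. Qed.
Let dP : forall z, differentiable P z. Proof. by have [] := P_C1. Qed.

Lemma is_diff_dotv (l w : 'rV[R]_p) :
  is_diff w (fun w => dotv w l : R^o) (fun w => dotv w l : R^o).
Proof.
have lin : linear (fun w : 'rV[R]_p => dotv w l : R^o).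
  by move=> a u v; rewrite dotvDl dotvZl.
pose L : {linear 'rV[R]_p -> R^o} :=
  HB.pack (fun w : 'rV[R]_p => dotv w l : R^o) (GRing.isLinear.Build _ _ _ _ _ lin).
have cL : continuous L.
  move=> v; have FF : Filter (nbhs (v : 'rV[R]_p)) by exact: nbhs_filter.
  exact: (@cvg_dotv _ _ _ _ FF (fun w => w) (cst l) _ _ cvg_id (cvg_cst l)).
split; first exact: (@linear_differentiable _ _ _ L).
exact: (@diff_lin _ _ _ L).
Qed.

Lemma gradxLE x y l u : gradxL f P x y l u =
  'd (f : _ -> R^o) (x, y) (u, 0) + dotv l ('d P (x, y) (u, 0)).
Proof.
rewrite /gradxL dotv_grad /lagrangian.
have h1 := is_diff_fst_slice (df (x, y)).
have h2 := is_diff_comp (is_diff_fst_slice (dP (x, y))) (is_diff_dotv l (P (x, y))).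
by have [_ ->] := is_diffD h1 h2; rewrite /= dotvC.
Qed.

Lemma diff_fE x y w v : 'd (f : _ -> R^o) (x, y) (w, v) =
  'd (f : _ -> R^o) (x, y) (w, 0) + dotv (grad (fun y' => f (x, y')) y) v.
Proof.
rewrite dotv_grad; have [_ ->] := is_diff_snd_slice (df (x, y)).
rewrite -linearD; congr ('d (f : _ -> R^o) (x, y) _).
by rewrite /GRing.add /= /add_pair /= addr0 add0r.
Qed.

Lemma diff_PE x y w v : 'd P (x, y) (w, v) =
  'd P (x, y) (w, 0) + v *m (JacyP P x y)^T.
Proof. by rewrite -!derPE// /derP mul0mx addr0. Qed.

Lemma solutions_value x y : solutions f P C x y -> value f P C x = (f (x, y))%:E.
Proof.
move=> [Fy hy]; apply/eqP; rewrite eq_le; apply/andP; split.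
  by apply: ge_ereal_inf; exists (f (x, y))%:E => //; exists y.
by apply: le_ereal_inf_tmp => _ [y' Fy' <-]; rewrite lee_fin; exact: hy.
Qed.

Lemma feasible_value x y : feasible P C x y -> (value f P C x <= (f (x, y))%:E)%E.
Proof. by move=> Fy; apply: ge_ereal_inf; exists (f (x, y))%:E => //; exists y. Qed.

(* Multipliers [l] killed by the Jacobian in [y] pair with [derP x y (s *: u) v]
   independently of [v]; feasibility for both signs makes this pairing vanish. *)
Lemma qualification x y u :
  (forall s : R, s = 1 \/ s = -1 -> dir_regular P C x y (s *: u)) ->
  forall l, clarke_normal C (P (x, y)) l -> l *m JacyP P x y = 0 -> l = 0.
Proof.
move=> REG l Kl lB.
have [[v1 hv1] reg1] := REG 1 (or_introl erefl).
have [[v2 hv2] _] := REG (-1) (or_intror erefl).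
apply: (reg1 v1 hv1) => //.
have := clarke_normal_regular_tangent Kl hv1.
have := clarke_normal_regular_tangent Kl hv2.
rewrite /derP !dotvDr -!dotv_mulmx lB !dotv0l !addr0.
rewrite !dotvZr.
by rewrite mulN1r oppr_le0 mul1r => h1 h2; apply/eqP; rewrite eq_le h1 h2.
Qed.

Section Point.
Variables (x u : 'rV[R]_n) (y : 'rV[R]_m).
Hypothesis Sy : solutions f P C x y.
Hypothesis RS : robinson_stable P C x y u.
Hypothesis CQ :
  forall l, clarke_normal C (P (x, y)) l -> l *m JacyP P x y = 0 -> l = 0.

Let K := clarke_normal C (P (x, y)).
Let K_closed : closed K. Proof. exact: closed_closure. Qed.
Let Cz : C (P (x, y)). Proof. by have [] := Sy. Qed.
Let K_cone : convex_cone K. Proof. exact: clarke_normal_convex_cone. Qed.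

Lemma clarke_multipliers_nonempty : clarke_multipliers f P C x y !=set0.
Proof.
have [v hv|l [Kl lB]] := @farkas R p m K (JacyP P x y) K_closed K_cone CQ
    (- grad (fun y' => f (x, y')) y); last first.
  by exists l; split => //; rewrite lB addrN.
rewrite dotvNl oppr_le0; apply/ler_addgt0Pr => e e0; rewrite -lerBlDr sub0r lerNl.
have polar l : limiting_normal C (P (x, y)) l -> dotv l ('d P (x, y) (0, v)) <= 0.
  move=> /limiting_normal_clarke Kl; rewrite diff_PE dotvDr -dotv_mulmx.
  by rewrite linear0 dotv0r add0r; exact: hv.
have [r [e0' [d0 [r0 e00 d00 h]]]] := value_step f_C1 P_C1 C_closed RS polar e0.
have r20 : 0 < r / 2 by exact: divr_gt0.
have r2r : r / 2 < r by lra.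
have [F1 ymin] := Sy.
have dir : dir_nbhd e0' d0 u (x + (r / 2) *: 0 - x).
  by rewrite scaler0 addr0 subrr; exact: dir_nbhd0.
have zr k (z : 'rV[R]_k) : `|z - z| < r by rewrite subrr normr0.
have [y2] := h x y 0 _ (zr _ _) (zr _ _) (zr _ _) r20 r2r F1 dir.
rewrite scaler0 addr0 => -[F2]; move: (ymin _ F2) => h1 h2.
have := le_trans h1 h2; rewrite lerDl pmulr_rge0//.
by rewrite diff_fE linear0 add0r; lra.
Qed.

Lemma clarke_multipliers_compact : compact (clarke_multipliers f P C x y).
Proof.
have [c hc] := cone_image_bound K_closed K_cone CQ.
apply: bounded_closed_compact.
  exists (c * `|grad (fun y' => f (x, y')) y|); split; first exact: num_real.
  move=> M hM l [Kl /eqP]; rewrite addrC addr_eq0 => /eqP lB /=.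
  by apply: le_trans (ltW hM); apply: le_trans (hc _ Kl) _; rewrite lB normrN.
move=> l /closure_seqP[s [hs sl]]; split.
  apply: (@closed_cvg _ _ \oo _ s K) => //.
  by exists 0%N => // k _; have [] := hs k.
apply/eqP; rewrite addrC addr_eq0; apply/eqP.
apply: (@cvg_unique 'rV[R]_m _ _ _ _ _ (cvg_mulmx (B := JacyP P x y) sl)) => //.
have -> : (fun k => s k *m JacyP P x y) = fun=> - grad (fun y' => f (x, y')) y.
  apply/funext => k; have [_ /eqP] := hs k.
  by rewrite addrC addr_eq0 => /eqP.
exact: cvg_cst.
Qed.

Lemma gradxL_extrema : exists lo hi : R,
  is_min [set gradxL f P x y l u | l in clarke_multipliers f P C x y] lo /\
  is_max [set gradxL f P x y l u | l in clarke_multipliers f P C x y] hi.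
Proof.
have ct : {within clarke_multipliers f P C x y, continuous (fun l => gradxL f P x y l u)}.
  apply: continuous_subspaceT => l; rewrite (_ : (fun l => _) =
      fun l => 'd (f : _ -> R^o) (x, y) (u, 0) + dotv l ('d P (x, y) (u, 0))).
    have FF : Filter (nbhs (l : 'rV[R]_p)) by exact: nbhs_filter.
    apply: cvgD; first exact: cvg_cst.
    exact: (@cvg_dotv _ _ _ _ FF (fun w => w) (cst _) _ _ cvg_id (cvg_cst _)).
  by apply/funext => k; rewrite gradxLE.
have [l1 L1 h1] := EVT_min_rV clarke_multipliers_nonempty clarke_multipliers_compact ct.
have [l2 L2 h2] := EVT_max_rV clarke_multipliers_nonempty clarke_multipliers_compact ct.
exists (gradxL f P x y l1 u), (gradxL f P x y l2 u); split; split.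
- by exists l1 => //; exact: set_mem.
- by move=> _ [l /mem_set Ll <-]; exact: h1.
- by exists l2 => //; exact: set_mem.
- by move=> _ [l /mem_set Ll <-]; exact: h2.
Qed.

Lemma optimal_step (w : 'rV[R]_n) (M eps : R) :
  (forall l, clarke_multipliers f P C x y l -> gradxL f P x y l w <= M) ->
  0 < eps ->
  exists r e0 d0 : R, [/\ 0 < r, 0 < e0, 0 < d0 &
    forall x1 y1 w' t, `|x1 - x| < r -> `|y1 - y| < r -> `|w' - w| < r ->
      0 < t -> t < r -> feasible P C x1 y1 ->
      dir_nbhd e0 d0 u (x1 + t *: w' - x) ->
      exists y2, feasible P C (x1 + t *: w') y2 /\
        f (x1 + t *: w', y2) <= f (x1, y1) + t * (M + eps)].
Proof.
move=> hM eps0; have e20 : 0 < eps / 2 by exact: divr_gt0.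
have [v [polar hv]] : exists v, (forall l, K l ->
      dotv l ('d P (x, y) (w, 0) + v *m (JacyP P x y)^T) <= 0) /\
    dotv (grad (fun y' => f (x, y')) y) v <=
      M - 'd (f : _ -> R^o) (x, y) (w, 0) + eps / 2.
  apply: conic_duality => //.
    by have [l [Kl lB]] := clarke_multipliers_nonempty; exists l.
  move=> l Kl lB; rewrite lerBrDl -gradxLE; exact: hM.
have polar' l : limiting_normal C (P (x, y)) l -> dotv l ('d P (x, y) (w, v)) <= 0.
  by move=> /limiting_normal_clarke Kl; rewrite diff_PE; exact: polar.
have [r [e0 [d0 [r0 e00 d00 h]]]] := value_step f_C1 P_C1 C_closed RS polar' e20.
exists r, e0, d0; split=> // x1 y1 w' t hx hy hw t0 tr F1 dir.
have [y2 [F2 h2]] := h x1 y1 w' t hx hy hw t0 tr F1 dir.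
exists y2; split => //; apply: le_trans h2 _.
by rewrite lerD2l ler_pM2l// diff_fE; lra.
Qed.

End Point.
End Multipliers.

(** * The value function *)

Section DiniDerivatives.
Context {R : realType} {n : nat}.
Variables (V : 'rV[R]_n -> \bar R) (x u : 'rV[R]_n) (c : R).
Hypothesis Vx : V x = c%:E.

Let box (r : R) : set (R * 'rV[R]_n) :=
  [set q | [/\ 0 < q.1, q.1 < r & `|q.2 - u| < r]].

Let box_filter (r : R) : 0 < r -> filter_prod 0^'+ (nbhs u) (box r).
Proof.
move=> r0; exists ([set t | 0 < t < r], [set u' | `|u' - u| < r]).
  split => /=.
    near=> t; apply/andP; split; first by near: t; exact: nbhs_right_gt.
    by near: t; exact: nbhs_right_lt.
  by apply: filterS (nbhsx_ballx u r r0) => u'; rewrite -ball_normE /= distrC.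
by move=> [t u'] /= [/andP[]].
Unshelve. all: by end_near. Qed.

Let quotient_le (t a : R) (u' : 'rV[R]_n) : 0 < t ->
  (diff_quotient V x (t, u') <= a%:E)%E = (V (x + t *: u') <= (c + t * a)%:E)%E.
Proof.
move=> t0; rewrite /diff_quotient /= Vx lee_pdivrMr// leeBlDr//.
by rewrite -EFinM -EFinD (addrC c) (mulrC t).
Qed.

Lemma dini_upper_le (M : R) :
  (forall e : R, 0 < e -> exists r : R, 0 < r /\ forall t u', 0 < t -> t < r ->
    `|u' - u| < r -> (V (x + t *: u') <= (c + t * (M + e))%:E)%E) ->
  (dini_upper V x u <= M%:E)%E.
Proof.
move=> h; apply/lee_addgt0Pr => e e0; have [r [r0 hr]] := h e e0.
rewrite /dini_upper limf_esupE; apply: ge_ereal_inf.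
exists (ereal_sup (diff_quotient V x @` box r)).
  by exists (box r) => //; exact: box_filter.
apply: ge_ereal_sup => _ [[t u'] [/= t0 tr ur] <-].
by rewrite -EFinD quotient_le//; exact: hr.
Qed.

Lemma dini_lower_lt (a r : R) : 0 < r -> (dini_lower V x u < a%:E)%E ->
  exists t u', [/\ 0 < t, t < r, `|u' - u| < r &
    (V (x + t *: u') <= (c + t * a)%:E)%E].
Proof.
move=> r0; rewrite /dini_lower limf_einfE => la.
have : (ereal_inf (diff_quotient V x @` box r) < a%:E)%E.
  apply: le_lt_trans la; apply: le_ereal_sup_tmp.
  exists (ereal_inf (diff_quotient V x @` box r)) => //.
  by exists (box r) => //; exact: box_filter.
move=> /ereal_inf_lt[_ [[t u'] [/= t0 tr ur] <-]] /ltW.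
by rewrite quotient_le// => h; exists t, u'.
Qed.

Lemma dini_lower_le_upper : (dini_lower V x u <= dini_upper V x u)%E.
Proof.
rewrite /dini_lower /dini_upper limf_einfE limf_esupE.
apply: ge_ereal_sup => _ [A FA <-]; apply: le_ereal_inf_tmp => _ [B FB <-].
have [q [Aq Bq]] : (A `&` B) !=set0.
  by apply: (@filter_ex _ (filter_prod 0^'+ (nbhs u))); exact: filterI.
apply: (@le_trans _ _ (diff_quotient V x q)).
  by apply: ge_ereal_inf; exists (diff_quotient V x q) => //; exists q.
by apply: le_ereal_sup_tmp; exists (diff_quotient V x q) => //; exists q.
Qed.

End DiniDerivatives.

Section ValueFunction.
Context {R : realType} {n m p : nat}.
Variables (f : 'rV[R]_n * 'rV[R]_m -> R) (P : 'rV[R]_n * 'rV[R]_m -> 'rV[R]_p).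
Variables (C : set 'rV[R]_p) (x u : 'rV[R]_n) (Omega : set 'rV[R]_m).
Hypothesis f_C1 : C1 (f : 'rV[R]_n * 'rV[R]_m -> R^o).
Hypothesis P_C1 : C1 P.
Hypothesis C_closed : closed C.
Hypothesis RIC : restricted_inf_compact f P C x u Omega.
Hypothesis RS : forall y, (solutions f P C x `&` Omega) y ->
  robinson_stable P C x y u.
Hypothesis REG : forall y, (solutions f P C x `&` Omega) y ->
  forall s : R, s = 1 \/ s = -1 -> dir_regular P C x y (s *: u).

Let V := value f P C.
Let Su := dir_solutions f P C x u `&` Omega.
Let dL := fun y lambda => gradxL f P x y lambda u.
Let S0 := solutions f P C x `&` Omega.

Lemma solutions_nonempty : S0 !=set0.
Proof.
have [_ Vx [e [d [e0 d0 h]]]] := RIC; apply: h; first by rewrite subrr; exact: dir_nbhd0.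
by rewrite lteDl// lte_fin.
Qed.

Let extrema y : S0 y -> exists lo hi : R,
  is_min [set dL y l | l in clarke_multipliers f P C x y] lo /\
  is_max [set dL y l | l in clarke_multipliers f P C x y] hi.
Proof.
move=> Sy; have [Sy1 _] := Sy.
exact (gradxL_extrema f_C1 P_C1 C_closed Sy1 (RS Sy) (qualification (REG Sy))).
Qed.

Lemma value_upper y hi (e : R) : S0 y ->
  is_max [set dL y l | l in clarke_multipliers f P C x y] hi -> 0 < e ->
  exists r : R, 0 < r /\ forall t u', 0 < t -> t < r -> `|u' - u| < r ->
    (V (x + t *: u') <= (f (x, y) + t * (hi + e))%:E)%E.
Proof.
move=> Sy [_ hmax] e0; have [[Fy _] _] := Sy.
have hM l : clarke_multipliers f P C x y l -> gradxL f P x y l u <= hi.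
  by move=> Ll; apply: hmax; exists l.
have [r [e1 [d1 [r0 e10 d10 h]]]] :=
  optimal_step f_C1 P_C1 C_closed Sy.1 (RS Sy) (qualification (REG Sy)) hM e0.
have [r' [r'0 h']] := dir_nbhd_cone u e10 d10.
exists (Num.min r r'); split; first by rewrite lt_min r0.
move=> t u' t0; rewrite !lt_min => /andP[tr tr'] /andP[ur ur'].
have [|||y2 [F2 h2]] := h x y u' t _ _ ur t0 tr Fy.
- by rewrite subrr normr0.
- by rewrite subrr normr0.
- by rewrite addrAC subrr add0r; exact: h'.
by apply: le_trans (feasible_value f F2) _; rewrite lee_fin.
Qed.

(* A limit of solutions at the points [x + t k *: u_ k] is a directional
   solution; stepping back from them to [x] along [- u] bounds the difference
   quotients from below. *)
Lemma value_lower (t c_ : nat -> R) (u_ : nat -> 'rV[R]_n) (c : R) :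
  V x = c%:E -> (forall k, 0 < t k) -> t @ \oo --> (0 : R) -> u_ @ \oo --> u ->
  (forall k, (V (x + t k *: u_ k) <= (c + t k * c_ k)%:E)%E) ->
  exists y, Su y /\ forall lo (e : R) (N : nat),
    is_min [set dL y l | l in clarke_multipliers f P C x y] lo -> 0 < e ->
    exists k, (N <= k)%N /\ lo <= c_ k + e.
Proof.
move=> Vx t0 tc uc Vc.
have tc' e : 0 < e -> exists N, forall k, (N <= k)%N -> t k < e.
  move=> e0; have /(@cvg_seqP R R^o)/(_ e e0)[N hN] := tc.
  by exists N => k /hN; rewrite subr0 gtr0_norm.
have [y0 Sy0] := solutions_nonempty; have [lo0 [hi0 [_ hhi0]]] := extrema Sy0.
have fc : f (x, y0) = c by have := solutions_value Sy0.1; rewrite -/V Vx => -[].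
have [r [r0 hr]] := value_upper Sy0 hhi0 ltr01.
have [cO _ [e1 [d1 [e10 d10 hRIC]]]] := RIC.
have [r' [r'0 hr']] := dir_nbhd_cone u e10 d10.
have [N1 hN1] : exists N1, forall k, (N1 <= k)%N ->
    solutions f P C (x + t k *: u_ k) `&` Omega !=set0.
  have h0 : 0 < `|hi0 + 1| + 1 by rewrite ltr_wpDl.
  have rr' : 0 < Num.min r r' by rewrite lt_min r0.
  have rre : 0 < Num.min (Num.min r r') (e1 / (`|hi0 + 1| + 1)).
    by rewrite lt_min rr' divr_gt0.
  have [Na hNa] := tc' _ rre.
  have /cvg_seqP/(_ _ rr')[Nb hNb] := uc.
  exists (maxn Na Nb) => k; rewrite geq_max => /andP[/hNa tk /hNb uk].
  move: tk uk; rewrite !lt_min => /andP[/andP[tr tr'] te] /andP[ur ur'].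
  apply: hRIC; first by rewrite addrAC subrr add0r; exact: hr'.
  apply: le_lt_trans (hr _ _ (t0 k) tr ur) _; rewrite -/V Vx -EFinD lte_fin fc ltrD2l.
  apply: (@le_lt_trans _ _ (t k * `|hi0 + 1|)); first by rewrite ler_pM2l// ler_norm.
  by move: te; rewrite ltr_pdivlMr// mulrDr mulr1; have := t0 k; lra.
have /choice[ys hys] (k : nat) : exists y,
    (solutions f P C (x + t (N1 + k)%N *: u_ (N1 + k)%N) `&` Omega) y.
  by apply: hN1; rewrite leq_addr.
have [phi [y [Oy kphi ysy]]] := compact_subseq cO (fun k => (hys k).2).
pose psi k := (N1 + phi k)%N.
have kpsi k : (k <= psi k)%N by rewrite (leq_trans (kphi k))// leq_addl.
pose y_ k := ys (phi k); pose x_ k := x + t (psi k) *: u_ (psi k).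
have Sk k : solutions f P C (x_ k) (y_ k) by have [] := hys (phi k).
have tpsi : (fun k => t (psi k)) @ \oo --> (0 : R) by exact: cvg_comp_subseq tc.
have upsi : (fun k => u_ (psi k)) @ \oo --> u by exact: cvg_comp_subseq uc.
have xx : x_ @ \oo --> x.
  have : (fun k => x + t (psi k) *: u_ (psi k)) @ \oo --> x + 0 *: u.
    by apply: cvgD; [exact: cvg_cst | exact: cvgZ].
  by rewrite scale0r addr0.
have xy : (fun k => (x_ k, y_ k)) @ \oo --> (x, y).
  exact: (@cvg_pair _ _ _ \oo (nbhs x) (nbhs y) _ _ _ x_ y_ xx ysy).
have Fy : feasible P C x y.
  apply: (@closed_cvg _ _ \oo _ (fun k => P (x_ k, y_ k)) C) => //.
    by exists 0%N => // k _; have [] := Sk k.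
  have := differentiable_continuous ((proj1 P_C1) (x, y)).
  exact: cvg_comp xy.
have fk k : f (x_ k, y_ k) <= c + t (psi k) * c_ (psi k).
  by rewrite -lee_fin -(solutions_value (Sk k)); exact: Vc.
have fy : f (x, y) <= c.
  have fcont : (fun k => f (x_ k, y_ k)) @ \oo --> f (x, y).
    have := differentiable_continuous ((proj1 f_C1) (x, y)).
    exact: cvg_comp xy.
  have tcont : (fun k => c + t (psi k) * (hi0 + 1)) @ \oo --> c.
    have : (fun k => c + t (psi k) * (hi0 + 1)) @ \oo --> c + 0 * (hi0 + 1).
      by apply: cvgD; [exact: cvg_cst | apply: cvgM => //; exact: cvg_cst].
    by rewrite mul0r addr0.
  apply: (ler_cvg_to fcont tcont).
  have [Na hNa] := tc' _ r0.
  have /cvg_seqP/(_ r r0)[Nb hNb] := uc.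
  exists (maxn Na Nb) => // k /=; rewrite geq_max => /andP[ka kb].
  rewrite -lee_fin -(solutions_value (Sk k)) -fc; apply: hr => //.
    by apply: hNa; exact: leq_trans ka (kpsi k).
  by apply: hNb; exact: leq_trans kb (kpsi k).
have Sy : solutions f P C x y.
  split=> // y' Fy'; apply: le_trans fy _; rewrite -lee_fin -Vx; exact: feasible_value.
exists y; split.
  split=> //; split => //.
  by exists (fun k => t (psi k)), (fun k => u_ (psi k)), y_.
move=> lo e N [_ hlo] e0; have S0y : S0 y by [].
have hM l : clarke_multipliers f P C x y l -> gradxL f P x y l (- u) <= - lo.
  move=> Ll; have := hlo _ (ex_intro2 _ _ l Ll erefl); rewrite /dL !gradxLE//.
  have -> : (- u, 0) = - (u, 0) :> 'rV[R]_n * 'rV[R]_m.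
    by rewrite -[RHS]/(- u, - 0) oppr0.
  by rewrite !linearN dotvNr /=; lra.
have [r1 [e2 [d2 [r10 e20 d20 h]]]] :=
  optimal_step f_C1 P_C1 C_closed Sy (RS S0y) (qualification (REG S0y)) hM e0.
have [Na hNa] := tc' _ r10.
have /cvg_seqP/(_ r1 r10)[Nb hNb] := uc.
have /cvg_seqP/(_ r1 r10)[Nx hNx] := xx.
have /cvg_seqP/(_ r1 r10)[Ny hNy] := ysy.
pose k := maxn (maxn N Na) (maxn Nb (maxn Nx Ny)).
have kN : (N <= k)%N by rewrite /k !leq_max leqnn.
have ka : (Na <= k)%N by rewrite /k !leq_max leqnn !orbT.
have kb : (Nb <= k)%N by rewrite /k !leq_max leqnn !orbT.
have kx : (Nx <= k)%N by rewrite /k !leq_max leqnn !orbT.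
have ky : (Ny <= k)%N by rewrite /k !leq_max leqnn !orbT.
exists (psi k); split; first exact: leq_trans kN (kpsi k).
have back : x_ k + t (psi k) *: - u_ (psi k) = x by rewrite scalerN addrK.
have [||||y2] := h (x_ k) (y_ k) (- u_ (psi k)) (t (psi k))
  (hNx _ kx) (hNy _ ky) _ (t0 _).
- rewrite opprK addrC distrC; apply: hNb; exact: leq_trans kb (kpsi k).
- by apply: hNa; exact: leq_trans ka (kpsi k).
- by have [] := Sk k.
- by rewrite back subrr; exact: dir_nbhd0.
rewrite back => -[F2 h2]; have := feasible_value f F2; rewrite -/V Vx lee_fin => h3.
have := fk k => h4.
have : t (psi k) * (lo - e - c_ (psi k)) <= 0 by lra.
by rewrite pmulr_rle0//; lra.
Qed.

End ValueFunction.

Section LowerBound.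
Context {R : realType} {n m p : nat}.
Variables (f : 'rV[R]_n * 'rV[R]_m -> R) (P : 'rV[R]_n * 'rV[R]_m -> 'rV[R]_p).
Variables (C : set 'rV[R]_p) (x u : 'rV[R]_n) (Omega : set 'rV[R]_m).
Hypothesis f_C1 : C1 (f : 'rV[R]_n * 'rV[R]_m -> R^o).
Hypothesis P_C1 : C1 P.
Hypothesis C_closed : closed C.
Hypothesis RIC : restricted_inf_compact f P C x u Omega.
Hypothesis RS : forall y, (solutions f P C x `&` Omega) y ->
  robinson_stable P C x y u.
Hypothesis REG : forall y, (solutions f P C x `&` Omega) y ->
  forall s : R, s = 1 \/ s = -1 -> dir_regular P C x y (s *: u).

Let V := value f P C.
Let dL := fun y lambda => gradxL f P x y lambda u.

Lemma dini_upper_value y hi : (solutions f P C x `&` Omega) y ->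
  is_max [set dL y l | l in clarke_multipliers f P C x y] hi ->
  (dini_upper V x u <= hi%:E)%E.
Proof.
move=> Sy hhi; apply: (dini_upper_le (solutions_value Sy.1)) => e e0.
exact (value_upper f_C1 P_C1 C_closed RS REG Sy hhi e0).
Qed.

Lemma dini_lower_value (hi : R) : (dini_upper V x u <= hi%:E)%E ->
  exists y, (dir_solutions f P C x u `&` Omega) y /\
    forall lo, is_min [set dL y l | l in clarke_multipliers f P C x y] lo ->
      (lo%:E <= dini_lower V x u)%E.
Proof.
move=> upper_hi; have [y0 [Sy0 _]] := solutions_nonempty RIC.
have Vx := solutions_value Sy0.
have lower_hi := le_trans (dini_lower_le_upper V x u) upper_hi.
pose c k := if dini_lower V x u is r%:E then r + k.+1%:R^-1 else - k%:R : R.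
have lc k : (dini_lower V x u < (c k)%:E)%E.
  rewrite /c; case: (dini_lower V x u) lower_hi => [r _|//|_].
    by rewrite lte_fin ltrDl invr_gt0.
  exact: ltNyr.
have /choice[tu htu] (k : nat) : exists tu : R * 'rV[R]_n,
    [/\ 0 < tu.1, tu.1 < k.+1%:R^-1, `|tu.2 - u| < k.+1%:R^-1 &
      (V (x + tu.1 *: tu.2) <= (f (x, y0) + tu.1 * c k)%:E)%E].
  have k0 : 0 < k.+1%:R^-1 :> R by rewrite invr_gt0.
  by have [t [u' ?]] := dini_lower_lt Vx k0 (lc k); exists (t, u').
have t0 k : 0 < (tu k).1 by have [] := htu k.
have tc : (fun k => (tu k).1) @ \oo --> (0 : R).
  apply: (@cvg_seq_harmonic R R^o) => k; rewrite subr0 gtr0_norm//.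
  by have [_ /ltW] := htu k.
have uc : (fun k => (tu k).2) @ \oo --> u.
  by apply: cvg_seq_harmonic => k; have [_ _ /ltW] := htu k.
have hV k : (V (x + (tu k).1 *: (tu k).2) <= (f (x, y0) + (tu k).1 * c k)%:E)%E.
  by have [] := htu k.
have [y [Suy hy]] := value_lower f_C1 P_C1 C_closed RIC RS REG Vx t0 tc uc hV.
exists y; split => // lo hlo.
case E : (dini_lower V x u) => [r| |]; last 1 first.
- have [k [kN]] := hy lo 1 (Num.truncn (1 - lo)).+1 hlo ltr01.
  rewrite /c E => h; have := truncnS_gt (1 - lo).
  have : (Num.truncn (1 - lo)).+1%:R <= k%:R :> R by rewrite ler_nat.
  move=> h1 h2; suff: lo < lo by rewrite ltxx.
  lra.
- suff h (e : R) : 0 < e -> lo <= r + e by rewrite lee_fin; exact/ler_addgt0Pr.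
  move=> e0; have e20 : 0 < e / 2 by exact: divr_gt0.
  have /cvgrPdist_lt/(_ _ e20)[N _ hN] := @cvg_harmonic R.
  have [k [kN]] := hy lo _ N hlo e20; rewrite /c E.
  have : k.+1%:R^-1 < e / 2.
    by have := hN k kN; rewrite /= sub0r normrN ger0_norm ?invr_ge0.
  by move=> h1 h2; apply: le_trans h2 _; rewrite -addrA lerD2l [leRHS]splitr lerD2r ltW.
- by rewrite leey.
Qed.

End LowerBound.

Theorem theorem4p1 (R : realType) (n m p : nat)
    (f : 'rV[R]_n * 'rV[R]_m -> R) (P : 'rV[R]_n * 'rV[R]_m -> 'rV[R]_p)
    (C : set 'rV[R]_p) (x u : 'rV[R]_n) (Omega : set 'rV[R]_m)
    (f_C1 : C1 (f : 'rV[R]_n * 'rV[R]_m -> R^o)) (P_C1 : C1 P)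
    (C_closed : closed C)
    (RIC : restricted_inf_compact f P C x u Omega)
    (RS : forall y, (solutions f P C x `&` Omega) y ->
       robinson_stable P C x y u)
    (REG : forall y, (solutions f P C x `&` Omega) y ->
       forall s : R, s = 1 \/ s = -1 -> dir_regular P C x y (s *: u)) :
  let V := value f P C in
  let Su := dir_solutions f P C x u `&` Omega in
  let Lambda := clarke_multipliers f P C x in
  let dL := fun y lambda => gradxL f P x y lambda u in
  Su !=set0 /\
  (exists lo hi : 'rV[R]_m -> R,
     [/\ forall y, Su y -> is_min [set dL y lambda | lambda in Lambda y] (lo y)
                        /\ is_max [set dL y lambda | lambda in Lambda y] (hi y),
         exists2 y, Su y & ((lo y)%:E <= dini_lower V x u)%E,
         (ereal_inf [set (lo y)%:E | y in Su] <= dini_lower V x u)%E,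
         (dini_lower V x u <= dini_upper V x u)%E
       & (dini_upper V x u <= ereal_inf [set (hi y)%:E | y in Su])%E]) /\
  (forall lbar : 'rV[R]_m -> 'rV[R]_p,
     (forall y, Su y -> Lambda y = [set lbar y]) ->
     exists d : R, is_hadamard_derivative V x u d /\
       is_min [set dL y (lbar y) | y in Su] d).
Proof.
move=> V Su Lambda dL.
have SuS y : Su y -> (solutions f P C x `&` Omega) y by move=> [[Sy _] Oy].
have extrema y : (solutions f P C x `&` Omega) y -> exists lo hi : R,
    is_min [set dL y l | l in Lambda y] lo /\ is_max [set dL y l | l in Lambda y] hi.
  move=> Sy; have [Sy1 _] := Sy.
  exact (gradxL_extrema f_C1 P_C1 C_closed Sy1 (RS y Sy) (qualification (REG y Sy))).
have upper y hi : (solutions f P C x `&` Omega) y ->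
    is_max [set dL y l | l in Lambda y] hi -> (dini_upper V x u <= hi%:E)%E.
  exact: dini_upper_value.
have [y1 [Suy1 lower]] : exists y, Su y /\ forall lo,
    is_min [set dL y l | l in Lambda y] lo -> (lo%:E <= dini_lower V x u)%E.
  have [y0 Sy0] := solutions_nonempty RIC; have [_ [hi0 [_ hhi0]]] := extrema _ Sy0.
  exact: dini_lower_value (upper _ _ Sy0 hhi0).
have lower_upper := dini_lower_le_upper V x u.
split; first by exists y1.
split=> [|lbar hlbar].
  have /choice[lohi hlohi] y : exists lohi : R * R, Su y ->
      is_min [set dL y l | l in Lambda y] lohi.1 /\
      is_max [set dL y l | l in Lambda y] lohi.2.
    have [/SuS/extrema[lo [hi h]]|nSu] := pselect (Su y); first by exists (lo, hi).
    by exists (0, 0).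
  exists (fun y => (lohi y).1), (fun y => (lohi y).2).
  have lo1 : (((lohi y1).1)%:E <= dini_lower V x u)%E.
    by apply: lower; have [] := hlohi _ Suy1.
  split => //; first by exists y1.
    by apply: ge_ereal_inf; exists ((lohi y1).1)%:E => //; exists y1.
  apply: le_ereal_inf_tmp => _ [y Suy <-].
  by apply: upper (SuS _ Suy) _; have [] := hlohi _ Suy.
have single y : Su y -> is_min [set dL y l | l in Lambda y] (dL y (lbar y)) /\
    is_max [set dL y l | l in Lambda y] (dL y (lbar y)).
  move=> Suy; rewrite (hlbar _ Suy).
  by split; split; [exists (lbar y) | move=> _ [_ -> <-] |
    exists (lbar y) | move=> _ [_ -> <-]].
have lo1 := lower _ (single _ Suy1).1.
have up y : Su y -> (dini_upper V x u <= (dL y (lbar y))%:E)%E.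
  by move=> Suy; exact: upper (SuS _ Suy) (single _ Suy).2.
exists (dL y1 (lbar y1)); split.
  split; apply/eqP; rewrite eq_le.
    by rewrite up//= (le_trans lo1).
  by rewrite lo1 andbT (le_trans lower_upper)// up.
split; first by exists y1.
move=> _ [y Suy <-]; rewrite -lee_fin.
exact: le_trans lo1 (le_trans lower_upper (up _ Suy)).
Qed.
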